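(* Let $X=(X_s)_{s\in[0,T]}$ be a centered continuous Gaussian process generated by a linear bounded operator $u:H\to C([0,T])$ on a separable Hilbert space $H$. Let $A=\{a_1,\dots,a_N\}\subset C([0,T])^*$ be a set of conditions such that $u^*a_1,\dots,u^*a_N$ are linearly independent in $H$, let $(e_i)_{i=1}^N$ be an orthonormal basis of the detached subspace $H_{(A)}$, and define the $N\times N$ matrix $B=(a_i(ue_j))_{1\le i,j\le N}$ and the random vector $b(X)=(a_1(X),\dots,a_N(X))^{\top}$. Then $B$ is invertible, and an anticipative representation of the conditioned process $X^{(A)}$ of $X$ with respect to $A$ is $$X^{(A)}=X-\sum_{i=1}^N \xi_i(X)\,(ue_i),$$ where $\xi(X)=(\xi_1(X),\dots,\xi_N(X))^\top=B^{-1}b(X)$; i.e. the process on the right-hand side is a conditioned process of $X$ with respect to $A$.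
   Context: $C([0,T])$ is the Banach space of continuous real functions on $[0,T]$ with the supremum norm; a condition is an element $a$ of $C([0,T])^*$ (a finite signed Borel measure, $a(f)=\int f\,da$). ''$X$ is generated by $u$'' means that for every orthonormal basis $(h_i)_{i\ge1}$ of $H$ and independent standard normal $(\omega_i)_{i\ge1}$, the series $\sum_i\omega_i(uh_i)$ converges almost surely in $C([0,T])$ and has the law of $X$. The adjoint $u^*:C([0,T])^*\to H$ is given by $\langle u^*a,h\rangle=a(uh)$. Reduced Hilbert space: $H^{(A)}=\{h\in H: a(uh)=0\text{ for all }a\in A\}$. Detached subspace: $H_{(A)}=H\ominus H^{(A)}=\operatorname{span}\{u^*a:a\in A\}$. A conditioned process $X^{(A)}$ of $X$ with respect to $A$ (defined only in law) is a continuous Gaussian process such that for all $b_1,\dots,b_n\in C([0,T])^*$ the law of $(b_1(X^{(A)}),\dots,b_n(X^{(A)}))$ is the conditional law of the Gaussian vector $(b_1(X),\dots,b_n(X))$ given $a(X)=0$ for all $a\in A$ in the sense of Gaussian conditioning, i.e. the law of $\big(b_k(X)-\mathbb E[b_k(X)\mid a(X),a\in A]\big)_{k=1}^n$. *)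

(* Defs.v *)
From HB Require Import structures.
From mathcomp Require Import all_boot all_order all_algebra.
From mathcomp Require Import all_classical all_reals all_analysis.

Set Implicit Arguments.
Unset Strict Implicit.
Unset Printing Implicit Defensive.

Import Order.TTheory GRing.Theory Num.Theory.
Import numFieldNormedType.Exports.

Local Open Scope classical_set_scope.
Local Open Scope ring_scope.

Definition C0T (R : realType) (T : R) : Type :=
  continuousType (set_type `[0, T]) R.

Section C0T_lmodule.
Context {R : realType} {T : R}.
Implicit Types f g : C0T T.

HB.instance Definition _ := Choice.on (C0T T).

Definition C0T_fun f : set_type `[0, T] -> R := f.

Lemma C0T_ext f g : C0T_fun f =1 C0T_fun g -> f = g.
Proof. by move=> fg; apply/continuousEP. Qed.

Lemma C0T_continuous f : continuous (C0T_fun f).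
Proof. exact: (@cts_fun _ _ f). Qed.

Definition C0T_zero : C0T T :=
  mkcts (fun=> @cst_continuous (set_type `[0, T]) R 0 _).

Lemma C0T_add_continuous f g :
  continuous (fun t => C0T_fun f t + C0T_fun g t).
Proof. move=> t; exact: cvgD (@C0T_continuous f t) (@C0T_continuous g t). Qed.

Definition C0T_add f g : C0T T := mkcts (@C0T_add_continuous f g).

Lemma C0T_opp_continuous f : continuous (fun t => - C0T_fun f t).
Proof. move=> t; exact: cvgN (@C0T_continuous f t). Qed.

Definition C0T_opp f : C0T T := mkcts (@C0T_opp_continuous f).

Lemma C0T_scale_continuous (c : R) f : continuous (fun t => c * C0T_fun f t).
Proof. move=> t; exact: cvgM (cvg_cst c) (@C0T_continuous f t). Qed.

Definition C0T_scale (c : R) f : C0T T := mkcts (@C0T_scale_continuous c f).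

Lemma C0T_addA : associative C0T_add.
Proof. by move=> f g h; apply: C0T_ext => t; exact: addrA. Qed.

Lemma C0T_addC : commutative C0T_add.
Proof. by move=> f g; apply: C0T_ext => t; exact: addrC. Qed.

Lemma C0T_add0 : left_id C0T_zero C0T_add.
Proof. by move=> f; apply: C0T_ext => t; exact: add0r. Qed.

Lemma C0T_addN : left_inverse C0T_zero C0T_opp C0T_add.
Proof. by move=> f; apply: C0T_ext => t; exact: addNr. Qed.

HB.instance Definition _ :=
  GRing.isZmodule.Build (C0T T) C0T_addA C0T_addC C0T_add0 C0T_addN.

Lemma C0T_scaleA a b f : C0T_scale a (C0T_scale b f) = C0T_scale (a * b) f.
Proof. by apply: C0T_ext => t; exact: mulrA. Qed.

Lemma C0T_scale1 : left_id 1 C0T_scale.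
Proof. by move=> f; apply: C0T_ext => t; exact: mul1r. Qed.

Lemma C0T_scaleDr : right_distributive C0T_scale +%R.
Proof. by move=> a f g; apply: C0T_ext => t; exact: mulrDr. Qed.

Lemma C0T_scaleDl f : {morph C0T_scale^~ f : a b / a + b}.
Proof. by move=> a b; apply: C0T_ext => t; exact: mulrDl. Qed.

HB.instance Definition _ := GRing.Zmodule_isLmodule.Build R (C0T T)
  C0T_scaleA C0T_scale1 C0T_scaleDr C0T_scaleDl.

Definition C0T_norm f : R := sup (range (fun t => `|C0T_fun f t|)).

Lemma C0T_bounded f : has_ubound (range (fun t => `|C0T_fun f t|)).
Proof.
have cF : {within `[0, T], continuous (valL_ (0 : R) (C0T_fun f))}.
  exact/subspace_valL_continuousP'/C0T_continuous.
have /compact_bounded[M [_ Mf]] :=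
  continuous_compact cF (@segment_compact R 0 T).
exists (M + 1) => _ [t _ <-].
apply: (Mf (M + 1)); first by rewrite ltrDl.
exists (set_val t); first exact: set_valP.
have := @valLK _ _ (0 : R) `[0, T]%classic (C0T_fun f).
by move=> /(congr1 (@^~ t)).
Qed.

Lemma C0T_norm_ub f t : `|C0T_fun f t| <= C0T_norm f.
Proof. by apply: ub_le_sup; [exact: C0T_bounded|exists t]. Qed.

Lemma C0T_norm_le f (c : R) :
  0 <= c -> (forall t, `|C0T_fun f t| <= c) -> C0T_norm f <= c.
Proof.
move=> c0 fc; rewrite /C0T_norm.
have [->|/set0P ne] := eqVneq (range (fun t => `|C0T_fun f t|)) set0.
  by rewrite sup0.
by apply: ge_sup => // _ [t _ <-].
Qed.

Lemma C0T_norm_ge0 f : 0 <= C0T_norm f.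
Proof.
rewrite /C0T_norm.
have [->|/set0P[_ [t _ _]]] := eqVneq (range (fun t => `|C0T_fun f t|)) set0.
  by rewrite sup0.
exact: le_trans (C0T_norm_ub f t).
Qed.

Lemma C0T_normD f g : C0T_norm (f + g) <= C0T_norm f + C0T_norm g.
Proof.
apply: C0T_norm_le; first by rewrite addr_ge0 ?C0T_norm_ge0.
by move=> t; rewrite (le_trans (ler_normD _ _))// lerD ?C0T_norm_ub.
Qed.

Lemma C0T_normZ_le (c : R) f : C0T_norm (c *: f) <= `|c| * C0T_norm f.
Proof.
apply: C0T_norm_le; first by rewrite mulr_ge0 ?C0T_norm_ge0.
by move=> t; rewrite [C0T_fun _ _]/(c * _) normrM ler_wpM2l ?C0T_norm_ub.
Qed.

Lemma C0T_normZ (c : R) f : C0T_norm (c *: f) = `|c| * C0T_norm f.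
Proof.
apply/le_anti; rewrite C0T_normZ_le/=; have [->|c0] := eqVneq c 0.
  by rewrite normr0 mul0r C0T_norm_ge0.
rewrite -ler_pdivlMl ?normr_gt0//.
by have := C0T_normZ_le c^-1 (c *: f); rewrite scalerA mulVf// scale1r normfV.
Qed.

Lemma C0T_norm0_eq0 f : C0T_norm f = 0 -> f = 0.
Proof.
move=> f0; apply: C0T_ext => t; apply/eqP.
by rewrite [C0T_fun 0 t]/(0 : R) -normr_le0 -f0 C0T_norm_ub.
Qed.

HB.instance Definition _ := Lmodule_isNormed.Build R (C0T T)
  C0T_normD C0T_normZ C0T_norm0_eq0.

(* Measurability of X : S -> C0T T is thus Borel measurability for the sup norm,
   which for continuous paths amounts to every X_t being a random variable. *)
HB.instance Definition _ := Measurable.copy (C0T T)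
  (g_sigma_algebraType (@open (C0T T))).

End C0T_lmodule.

Record dual (R : realType) (V : normedModType R) := Dual {
  dual_fun :> {linear V -> R^o};
  dual_continuous : continuous dual_fun }.

HB.mixin Record CompleteNormedModule_isHilbert (R : realType) H
    & CompleteNormedModule R H := {
  inner : H -> H -> R;
  innerC : forall x y, inner x y = inner y x;
  innerDl : forall x y z, inner (x + y) z = inner x z + inner y z;
  innerZl : forall (c : R) x y, inner (c *: x) y = c * inner x y;
  inner_norm : forall x, inner x x = `|x| ^+ 2 }.

#[short(type="hilbertType")]
HB.structure Definition Hilbert (R : realType) :=
  {H of CompleteNormedModule_isHilbert R H & CompleteNormedModule R H}.

Section Hilbert_definitions.
Context {R : realType}.

Definition separable (V : topologicalType) :=
  exists2 D : set V, countable D & dense D.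

Definition linear_span (V : lmodType R) (S : set V) : set V :=
  [set x | exists (n : nat) (c : 'I_n -> R) (v : 'I_n -> V),
    (forall i, S (v i)) /\ x = \sum_(i < n) c i *: v i].

Definition linearly_independent (V : lmodType R) n (v : 'I_n -> V) :=
  forall c : 'I_n -> R, \sum_(i < n) c i *: v i = 0 -> forall i, c i = 0.

Definition orthonormal_family (H : hilbertType R) (I : eqType) (D : set I)
    (e : I -> H) :=
  forall i j, D i -> D j -> inner (e i) (e j) = (i == j)%:R.

(* (e i)_{i in D} is an orthonormal basis of the closed subspace W. *)
Definition orthonormal_basis (H : hilbertType R) (W : set H) (I : eqType)
    (D : set I) (e : I -> H) :=
  [/\ orthonormal_family D e, e @` D `<=` W &
      W `<=` closure (linear_span (e @` D))].

Definition bounded_operator (V W : normedModType R) (u : V -> W) :=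
  exists M : R, forall x, `|u x| <= M * `|x|.

(* For bounded linear u, such a v exists and is unique by Riesz representation. *)
Definition adjoint (H : hilbertType R) (V : normedModType R) (u : H -> V)
    (a : dual V) : H :=
  xget 0 [set v | forall h, inner v h = a (u h)].

Definition reduced_space (H : hilbertType R) (V : normedModType R)
    (u : H -> V) (A : set (dual V)) : set H :=
  [set h | forall a, A a -> a (u h) = 0].

Definition detached_space (H : hilbertType R) (V : normedModType R)
    (u : H -> V) (A : set (dual V)) : set H :=
  [set h | forall g, reduced_space u A g -> inner h g = 0].

End Hilbert_definitions.

Section Probability_definitions.
Local Open Scope ereal_scope.
Context {R : realType}.

Definition same_law d d' d'' (S : measurableType d) (S' : measurableType d')
    (E : measurableType d'') (P : probability S R) (X : S -> E)
    (Q : probability S' R) (Y : S' -> E) :=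
  forall B : set E, measurable B -> pushforward P X B = pushforward Q Y B.

Definition independent_sequence d (S : measurableType d) (P : probability S R)
    (xi : nat -> S -> R) :=
  forall (J : seq nat) (B : nat -> set R), uniq J ->
    (forall i, measurable (B i)) ->
    P (\big[setI/setT]_(i <- J) (xi i @^-1` B i)) =
    \prod_(i <- J) P (xi i @^-1` B i).

(* [normal_prob m 0] is not the degenerate law at m. *)
Definition gaussian_law (m s : R) : set R -> \bar R :=
  if s == 0%R then dirac m else normal_prob m s.

Definition gaussian_variable d (S : measurableType d) (P : probability S R)
    (Y : S -> R) :=
  measurable_fun setT Y /\
  exists m s : R, (0 <= s)%R /\
    forall B : set R, measurable B -> pushforward P Y B = gaussian_law m s B.

Definition standard_normal d (S : measurableType d) (P : probability S R)
    (Y : S -> R) :=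
  measurable_fun setT Y /\
  forall B : set R, measurable B -> pushforward P Y B = normal_prob 0 1 B.

Definition is_cond_exp d (S : measurableType d) (P : probability S R)
    (G : set (set S)) (Y Z : S -> R) :=
  [/\ forall B : set R, measurable B -> G (Z @^-1` B),
      P.-integrable setT (EFin \o Z) &
      forall E, G E ->
        \int[P]_(w in E) (Z w)%:E = \int[P]_(w in E) (Y w)%:E].

(* A chosen version of E[Y | G]; the default 0 is never used for integrable Y
   when G is a sub-sigma-algebra. *)
Definition cond_exp d (S : measurableType d) (P : probability S R)
    (G : set (set S)) (Y : S -> R) : S -> R :=
  xget (cst 0%R) [set Z | is_cond_exp P G Y Z].

End Probability_definitions.

Section Process_definitions.
Context {R : realType} {T : R}.

Definition gaussian_process d (S : measurableType d) (P : probability S R)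
    (X : S -> C0T T) :=
  measurable_fun setT X /\
  forall n (t : 'I_n -> set_type `[0, T]) (c : 'I_n -> R),
    gaussian_variable P (fun w => \sum_(k < n) c k * C0T_fun (X w) (t k)).

Definition centered_process d (S : measurableType d) (P : probability S R)
    (X : S -> C0T T) :=
  forall t, 'E_P[fun w => C0T_fun (X w) t]%E = 0%E.

(* The basis is indexed by D = nat or, when H has finite dimension n, by
   D = {0, ..., n-1}. *)
Definition generated_by d (S : measurableType d) (P : probability S R)
    (X : S -> C0T T) (H : hilbertType R) (u : H -> C0T T) :=
  forall (D : set nat) (h : nat -> H),
    D = [set: nat] \/ (exists n, D = `I_n) ->
    orthonormal_basis [set: H] D h ->
  forall d' (S' : measurableType d') (Q : probability S' R)
      (xi : nat -> S' -> R),
    (forall i, standard_normal Q (xi i)) -> independent_sequence Q xi ->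
  exists Y : S' -> C0T T,
    [/\ measurable_fun setT Y,
        {ae Q, forall w,
          (fun n => \sum_(i < n | nat_of_ord i \in D) xi i w *: u (h i))
            @ \oo --> Y w} &
        same_law Q Y P X].

Definition generated_sigma_algebra d (S : measurableType d) (X : S -> C0T T)
    (A : set (dual (C0T T))) : set (set S) :=
  <<s \bigcup_(a in A)
        preimage_set_system setT (fun w => a (X w) : R) measurable >>.

(* Y, possibly on another probability space, is a conditioned process X^(A). *)
Definition conditioned_process d (S : measurableType d) (P : probability S R)
    (X : S -> C0T T) (A : set (dual (C0T T)))
    d' (S' : measurableType d') (Q : probability S' R) (Y : S' -> C0T T) :=
  gaussian_process Q Y /\
  forall n (b : 'I_n -> dual (C0T T)),
    same_law Q (fun w => [tuple (b k (Y w) : R) | k < n])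
             P (fun w => [tuple (b k (X w) : R) -
      cond_exp P (generated_sigma_algebra X A) (fun w' => b k (X w')) w
        | k < n]).

End Process_definitions.

(* Main.v *)
(* The reflection rho of H that fixes the detached subspace and negates its
   complement turns an orthonormal basis into another one, and both generate X
   from the same standard normal variables.  Writing L x for the sum of the
   xi_i(x) u(e_i), this shows that the law of X is invariant under the
   continuous linear involution x |-> 2 L x - x of C([0,T]), which preserves
   every condition and negates x - L x.  Hence the integral of f(X - L X) over
   any event determined by the conditions is its own opposite, that is 0, and
   E[f(X) | a(X)] = f(L X) for each functional f.  Gaussianity and integrability
   of f(X) are read off a basis that starts with u^* f / |u^* f|, for which only
   one term of the series contributes.
   All this needs one actual sequence of independent standard normal variables:
   it is built on [0,1] from the binary digits of a uniform variable. *)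
Require Import Defs.
From HB Require Import structures.
From mathcomp Require Import all_boot all_order all_algebra.
From mathcomp Require Import all_classical all_reals all_analysis.
From mathcomp Require Import measurable_realfun ring lra zify.

Import Order.TTheory GRing.Theory Num.Theory.
Import numFieldNormedType.Exports.

Local Open Scope classical_set_scope.
Local Open Scope ring_scope.

Set Implicit Arguments.
Unset Strict Implicit.
Unset Printing Implicit Defensive.

(** * Hilbert spaces *)

(** The usual route, that uncorrelated Gaussian variables are independent, would need the joint law
    of X - L X and the conditions. A symmetry replaces it: what [generated_by] gives directly is
    that two series have the same law, and changing the sign of the basis vectors outside the
    detached subspace produces such a pair. The map L can be read off the path because, in a basis h
    extending (e_i), every h_i of rank at least N (counting from 0) is orthogonal to all u^* a_j.
    The conditions then see only the first N terms of the series, b(X) = B omega, and inverting B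
    recovers these N coefficients. A concrete normal sequence is unavoidable, since [generated_by]
    speaks only of sequences that are given to it. *)

Section hilbert.
Context {R : realType} {H : hilbertType R}.
Implicit Types (x y z : H) (s : seq H).

Lemma innerDr x y z : inner x (y + z) = inner x y + inner x z.
Proof. by rewrite innerC innerDl !(innerC x). Qed.

Lemma innerZr (c : R) x y : inner x (c *: y) = c * inner x y.
Proof. by rewrite innerC innerZl innerC. Qed.

Lemma inner0l x : inner 0 x = 0.
Proof. by rewrite -(scale0r 0) innerZl mul0r. Qed.

Lemma innerNl x y : inner (- x) y = - inner x y.
Proof. by rewrite -scaleN1r innerZl mulN1r. Qed.

Lemma innerNr x y : inner x (- y) = - inner x y.
Proof. by rewrite innerC innerNl innerC. Qed.

Lemma inner_suml (I : Type) (r : seq I) (F : I -> H) y :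
  inner (\sum_(i <- r) F i) y = \sum_(i <- r) inner (F i) y.
Proof.
by elim/big_ind2 : _ => [|a b c e <- <-|//]; [exact: inner0l|exact: innerDl].
Qed.

Lemma inner_sqr_eq0 x : inner x x = 0 -> x = 0.
Proof. by rewrite inner_norm => /eqP; rewrite sqrf_eq0 normr_eq0 => /eqP. Qed.

Lemma Cauchy_Schwarz x y : `|inner x y| <= `|x| * `|y|.
Proof.
have [->|y0] := eqVneq y 0.
  by rewrite innerC inner0l !normr0 mulr0.
have y2 : 0 < `|y| ^+ 2 by rewrite exprn_gt0// normr_gt0.
rewrite -(@ler_pXn2r _ 2) ?nnegrE ?mulr_ge0// real_normK ?num_real// exprMn.
(* The vector is |y|^2 times the component of x orthogonal to y; its squared norm is |y|^2 (|x|^2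
   |y|^2 - <x,y>^2). *)
have : 0 <= `|(`|y| ^+ 2) *: x - inner x y *: y| ^+ 2 by exact: sqr_ge0.
rewrite -inner_norm !(innerDl, innerDr, innerZl, innerZr, innerNl, innerNr).
rewrite (innerC y x) !inner_norm => h.
rewrite -subr_ge0 -(pmulr_rge0 _ y2).
by apply: le_trans h _; rewrite le_eqVlt; apply/orP; left; apply/eqP; ring.
Qed.

Lemma inner_continuous x : continuous (inner x : H -> R).
Proof.
move=> y; apply/cvgrPdist_lt => e e0.
near=> z.
rewrite -innerNr -innerDr (le_lt_trans (Cauchy_Schwarz _ _))//.
have x1 : 0 < `|x| + 1 by rewrite ltr_wpDl.
rewrite (@le_lt_trans _ _ ((`|x| + 1) * `|y - z|))//.
  by rewrite ler_wpM2r// lerDl.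
rewrite -ltr_pdivlMl//.
near: z; apply: (cvgrPdist_lt _ _).1; last by rewrite mulr_gt0// invr_gt0.
exact: cvg_id.
Unshelve. all: by end_near. Qed.

(* The minimiser of |x|^2 - 2 f x, reached by a minimising sequence that is
   Cauchy by the parallelogram identity. *)
Lemma Riesz_representation (f : {linear H -> R^o}) (K : R) :
  (forall x, `|f x| <= K * `|x|) -> exists v, forall x, inner v x = f x.
Proof.
move=> fK.
pose J x := `|x| ^+ 2 - 2 * f x.
have JK x : - K ^+ 2 <= J x.
  have := fK x; rewrite ler_norml => /andP[_ fx].
  rewrite /J; have := sqr_ge0 (`|x| - K); nra.
have JE x y : J (x + y) = J x + `|y| ^+ 2 + 2 * (inner x y - f y).
  rewrite /J -!inner_norm !(innerDl, innerDr) (innerC y x) linearD /=.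
  by rewrite -[f x + f y]/((f x : R) + (f y : R)); ring.
pose I := inf (range J).
have IJ x : I <= J x.
  by apply: ge_inf; [exists (- K ^+ 2) => _ [z _ <-]|exists x].
have /choice[x xI] : forall n : nat, exists x, J x < I + n.+1%:R^-1.
  move=> n.
  have [] : exists2 z, range J z & z < I + n.+1%:R^-1.
    apply: inf_adherent; first by rewrite invr_gt0.
    by split; [exists (J 0); exists 0|exists (- K ^+ 2) => _ [z _ <-]].
  by move=> _ [z _ <-] zI; exists z.
(* Let d = x m - x n. The expansions of J at x n + d and x n + d/2 show that J at the midpoint is
   the mean of J (x m) and J (x n) minus |d|^2 / 4, and it is at least I. *)
have xx m n : `|x m - x n| ^+ 2 <= 2 * (m.+1%:R^-1 + n.+1%:R^-1).
  have := JE (x n) (x m - x n); rewrite subrKC.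
  have := JE (x n) (2^-1 *: (x m - x n)).
  rewrite normrZ exprMn ger0_norm ?invr_ge0// innerZr linearZ /=.
  rewrite -[2^-1 *: f _]/(2^-1 * (f _ : R)).
  move: (f _ : R) => q; move: (inner _ _) => p.
  have := IJ (x n + 2^-1 *: (x m - x n)); have := xI m; have := xI n.
  have -> : (2^-1 : R) ^+ 2 = 4^-1 by field.
  move: (n.+1%:R^-1) (m.+1%:R^-1) (`|_| ^+ 2) (J (_ + _)) (J (x n)) (J (x m)).
  move=> a b D Jd Jn Jm; lra.
have /cauchy_cvgP/cvg_ex[v xv] : cauchy (x @ \oo).
  apply/cauchy_ballP => e e0.
  have e4 : 0 < e ^+ 2 / 4 by rewrite divr_gt0// exprn_gt0.
  have [k ke] : exists k, forall n : nat, (k <= n)%N -> n.+1%:R^-1 < e ^+ 2 / 4.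
    have /cvgrPdist_lt/(_ _ e4)[k _ kP] := @cvg_harmonic R.
    exists k => n kn; have := kP _ kn.
    by rewrite /= sub0r normrN ger0_norm// invr_ge0.
  exists (x @` [set n | (k <= n)%N], x @` [set n | (k <= n)%N]).
    by split; exists k => // n kn; exists n.
  move=> [_ _] /= [[m km <-] [n kn <-]].
  rewrite -ball_normE /ball_/= -(@ltr_pXn2r _ 2) ?nnegrE ?(ltW e0)//.
  rewrite (le_lt_trans (xx _ _))//; have := ke _ km; have := ke _ kn.
  by move: (m.+1%:R^-1) (n.+1%:R^-1) (e ^+ 2) => a b c; lra.
have fc : continuous (f : H -> R^o).
  apply: bounded_linear_continuous.
  apply/linear_boundedP; exists K; split; first exact: num_real.
  by move=> r Kr y; rewrite (le_trans (fK _))// ler_wpM2r// ltW.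
have JvI : J v <= I.
  have Jx : J (x n) @[n --> \oo] --> J v.
    apply: cvgB.
      by apply: (cvg_comp _ (fun z : R => z ^+ 2)); [exact: cvg_norm xv|
        exact: sqr_continuous].
    by apply: cvgM; [exact: cvg_cst|apply: (cvg_comp _ f);
      [exact: xv|exact: fc]].
  have Ix : (I + n.+1%:R^-1) @[n --> \oo] --> I.
    rewrite -[X in _ --> X]addr0; apply: cvgD; first exact: cvg_cst.
    exact: cvg_harmonic.
  by apply: (ler_cvg_to Jx Ix); near=> n; rewrite ltW.
exists v => y; have [->|y0] := eqVneq y 0;
  first by rewrite innerC inner0l linear0.
have y2 : 0 < `|y| ^+ 2 by rewrite exprn_gt0// normr_gt0.
pose q : R := inner v y - f y.
(* The minimiser of t |-> J (v + t y). There J would drop by q^2 / |y|^2 below J v, which is already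
   minimal, so q = 0. *)
pose t : R := - (q / `|y| ^+ 2).
have := JE v (t *: y); have := IJ (v + t *: y).
have -> : f (t *: y) = t * f y by rewrite linearZ.
rewrite innerZr -mulrBr -/q normrZ exprMn real_normK ?num_real//.
move=> h1 h2.
have h3 : (q / `|y| ^+ 2) ^+ 2 * `|y| ^+ 2 = q ^+ 2 / `|y| ^+ 2.
  by field; rewrite normr_eq0.
have h4 : 0 <= - (q ^+ 2 / `|y| ^+ 2).
  move: h1; rewrite h2 sqrrN h3.
  have -> : 2 * (t * q) = - (2 * (q ^+ 2 / `|y| ^+ 2)).
    by rewrite /t expr2; ring.
  by move: (q ^+ 2 / _) (J v) JvI => a b; lra.
have : q ^+ 2 <= 0.
  by move: h4; rewrite oppr_ge0 pmulr_lle0 ?invr_gt0.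
rewrite le_eqVlt ltNge sqr_ge0 orbF sqrf_eq0 subr_eq0 => /eqP->//.
Unshelve. all: by end_near. Qed.

End hilbert.

(** * Gram-Schmidt and orthonormal bases of a separable space *)

Section orthonormalisation.
Context {R : realType} {H : hilbertType R}.
Implicit Types (x y : H) (s : seq H).

Definition orthonormal_seq s := forall i j : nat, (i < size s)%N ->
  (j < size s)%N -> inner s`_i s`_j = (i == j)%:R.

Definition residual s x := x - \sum_(y <- s) inner x y *: y.

Lemma residual_orthogonal s x i : orthonormal_seq s -> (i < size s)%N ->
  inner (residual s x) s`_i = 0.
Proof.
move=> os si; rewrite innerDl innerNl inner_suml (big_nth 0) big_mkord.
rewrite (bigD1 (Ordinal si))//= innerZl os// eqxx mulr1 big1 ?addr0 ?subrr//.
move=> j ji; rewrite innerZl os//.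
by have /negbTE-> : (nat_of_ord j != i) by []; rewrite mulr0.
Qed.

(** The difference y - [residual s y] lies in the span of s, to which [residual s x] is
    orthogonal. *)
Lemma inner_residual s x y : orthonormal_seq s ->
  inner y (residual s x) = inner (residual s y) (residual s x).
Proof.
move=> os; rewrite [residual s y]/residual innerDl innerNl inner_suml.
rewrite (big_nth 0) big_mkord big1 ?subr0// => i _.
by rewrite innerZl (innerC s`_i) residual_orthogonal// mulr0.
Qed.

Definition orthonormal_add s x :=
  rcons s (`|residual s x|^-1 *: residual s x).

Lemma orthonormal_add_seq s x : orthonormal_seq s -> residual s x != 0 ->
  orthonormal_seq (orthonormal_add s x).
Proof.
move=> os rx0 i j; rewrite /orthonormal_add size_rcons !ltnS !nth_rcons.
move=> si sj.
have [si1|si1] := ltnP i (size s); have [sj1|sj1] := ltnP j (size s).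
- by rewrite os.
- have -> : j = size s by lia.
  by rewrite eqxx innerZr innerC residual_orthogonal// mulr0 ltn_eqF.
- have -> : i = size s by lia.
  by rewrite eqxx innerZl residual_orthogonal// mulr0 gtn_eqF.
- have -> : j = size s by lia.
  have -> : i = size s by lia.
  rewrite eqxx innerZl innerZr inner_norm expr2.
  have n0 : `|residual s x| != 0 by rewrite normr_eq0.
  by rewrite mulrA -invfM mulVf// mulf_neq0.
Qed.

(** The two alternatives are what the Gram-Schmidt loop needs: vectors already in the span stay
    there, and the vector just processed enters it. *)
Lemma residual_add s x y : orthonormal_seq s ->
  residual s x != 0 -> residual s y = 0 \/ y = x ->
  residual (orthonormal_add s x) y = 0.
Proof.
move=> os rx0; rewrite /orthonormal_add [residual (rcons _ _) y]/residual.
rewrite -cats1 big_cat big_seq1 opprD addrA.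
rewrite -/(residual s y) innerZr inner_residual// scalerA mulrAC.
case=> [->|->]; first by rewrite inner0l mulr0 scale0r subr0.
rewrite inner_norm -expr2 -exprMn mulVf ?expr1n ?scale1r ?subrr//.
by rewrite normr_eq0.
Qed.

Lemma residual0_span s x : residual s x = 0 ->
  x = \sum_(i < size s) inner x s`_i *: s`_i.
Proof. by move/eqP; rewrite subr_eq0 => /eqP {1}->;
  rewrite (big_nth 0) big_mkord. Qed.

(** An injection of the dense set into nat is inverted. Indices outside its image get the default 0,
    which can only add a point to a dense range. *)
Lemma separable_seq : separable H -> exists x : nat -> H, dense (range x).
Proof.
move=> [D /countable_injP[f finj] Dd].
exists (fun k => xget 0 [set y | D y /\ f y = k]) => V V0 oV.
have [y [Vy Dy]] := Dd V V0 oV.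
exists y; split => //; exists (f y) => //.
case: xgetP => [z _ [Dz fzy]|/(_ y)[]]; last by split.
by apply: finj; rewrite ?inE.
Qed.

(* Gram-Schmidt on a dense sequence, started at [s0]; the new vector is always
   taken from the first term of the sequence outside the current span. *)
Lemma orthonormal_basis_extension s0 : separable H -> orthonormal_seq s0 ->
  exists (D : set nat) (h : nat -> H),
    [/\ D = [set: nat] \/ (exists n, D = `I_n),
        orthonormal_basis [set: H] D h &
        forall i, (i < size s0)%N -> D i /\ h i = s0`_i].
Proof.
move=> /separable_seq[x xd] os0.
have spanP (D : set nat) (h : nat -> H) :
    (forall k, linear_span (h @` D) (x k)) ->
    [set: H] `<=` closure (linear_span (h @` D)).
  move=> hx y _ B; rewrite nbhsE => -[V [oV Vy] VB].
  have [|z [/VB Bz [k _ xk]]] := xd V _ oV; first by exists y.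
  by exists (x k); split; [exact: hx|rewrite xk].
pose extends s := orthonormal_seq s /\ ((size s0 <= size s)%N /\
  forall i, (i < size s0)%N -> s`_i = s0`_i).
(* Either some finite extension of s0 already spans the dense sequence, and D is an initial segment,
   or every extension can be enlarged, and D is nat. *)
have [[s [[os [ss0 ss]] sx]]|nex] :=
    pselect (exists s, extends s /\ forall k, residual s (x k) = 0).
  exists `I_(size s); exists (nth 0 s); split; first by right; exists (size s).
    split; [by move=> i j; exact: os|by []|apply: spanP => k].
    exists (size s); exists (fun i => inner (x k) s`_i); exists (fun i => s`_i).
    by split; [move=> i; exists (nat_of_ord i) => /=|exact: residual0_span].
  by move=> i si; split; [exact: (leq_trans si)|exact: ss].
(* The last clause measures progress: if the first n terms are already spanned, the index of the
   term processed is at least n, so the first n.+1 terms are spanned afterwards. *)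
have step s : exists s', extends s -> [/\ orthonormal_seq s',
    exists g, s' = rcons s g & forall n, (forall j, (j < n)%N ->
      residual s (x j) = 0) -> forall j, (j < n.+1)%N -> residual s' (x j) = 0].
  have [es|] := pselect (extends s); last by exists s.
  have rk : exists k, residual s (x k) != 0.
    apply/not_existsP => rs; apply: nex; exists s; split=> // k.
    by apply/eqP/negP => /negP; exact: rs.
  case: (ex_minnP rk) => k rk0 kmin.
  exists (orthonormal_add s (x k)) => _; case: es => os _; split.
  - exact: orthonormal_add_seq.
  - by eexists.
  - move=> n sn j jn; apply: residual_add => //.
    have nk : (n <= k)%N.
      by rewrite leqNgt; apply/negP => /sn rk00; rewrite rk00 eqxx in rk0.
    have [jk|jk] := ltnP j k; last by right; congr x; lia.
    by left; apply/eqP/negP => /negP/kmin; lia.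
have {step}[F FP] := choice step.
pose t n := iter n F s0.
have text n : extends (t n) /\ size (t n) = (size s0 + n)%N.
  elim: n => [|n [et st]]; first by rewrite addn0; split=> //; split.
  rewrite /t iterS -/(t n); have [os' [g Fg] _] := FP _ et.
  have [_ [s0t tn]] := et.
  rewrite Fg size_rcons st addnS; split=> //; split; first by rewrite -Fg.
  rewrite size_rcons ltnW ?ltnS//; split=> // i si.
  by rewrite nth_rcons (leq_trans si s0t) tn.
have tres n j : (j < n)%N -> residual (t n) (x j) = 0.
  elim: n j => // n IHn j.
  by have [_ _] := FP _ (proj1 (text n)); apply.
have tn n m i : (n <= m)%N -> (i < size (t n))%N -> (t m)`_i = (t n)`_i.
  move=> nm si; rewrite -(subnK nm); elim: (m - n)%N => // k IHk.
  rewrite addSn /t iterS -/(t _).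
  have [et st] := text (k + n)%N; have [_ [g ->] _] := FP _ et.
  by rewrite nth_rcons st (_ : (i < _)%N) ?IHk//; move: si;
    rewrite (proj2 (text n)); lia.
have tnth n i : (i < size (t n))%N -> (t i.+1)`_i = (t n)`_i.
  move=> si; have [ni|ni] := leqP n i.+1; first exact: tn.
  by apply/esym/tn; [lia|rewrite (proj2 (text _)); lia].
(* Stage i.+1 has length size s0 + i.+1, hence an entry of rank i; by [tnth] every stage long enough
   has the same entry there. *)
exists setT; exists (fun i => (t i.+1)`_i); split; first by left.
  split => //.
    move=> i j _ _; rewrite !(tnth (i + j).+1) ?(proj2 (text _)); try lia.
    by apply: (proj1 (proj1 (text _))); rewrite (proj2 (text _)); lia.
  apply: spanP => k.
  exists (size (t k.+1)); exists (fun i => inner (x k) (t k.+1)`_i);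
    exists (fun i => (t k.+1)`_i).
  split; last exact/residual0_span/tres.
  by move=> i; exists (nat_of_ord i) => //; exact: tnth.
by move=> i si; split=> //; rewrite (tnth 0%N).
Qed.

End orthonormalisation.

(** * Independent standard normal variables *)

Lemma measurable_preimageT d1 d2 (S1 : measurableType d1)
    (S2 : measurableType d2) (f : S1 -> S2) A :
  measurable_fun setT f -> measurable A -> measurable (f @^-1` A).
Proof. by move=> mf mA; rewrite -[X in measurable X]setTI; exact: mf. Qed.

(** * The uniform law and the shift of binary digits *)

Section uniform_on_unit_interval.
Context {R : realType}.
Local Notation mR := (measurableTypeR R).
Local Notation U := (uniform_prob (@ltr01 R)).
Local Open Scope ereal_scope.

Lemma measure_oc_itv (m : {measure set mR -> \bar R}) (a b : R) :
  m setT < +oo -> (a <= b)%R ->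
  m `]a, b]%classic = m `]-oo, b]%classic - m `]-oo, a]%classic.
Proof.
move=> moo ab.
have -> : `]a, b]%classic = (`]-oo, b] `\` `]-oo, a])%classic :> set R.
  apply/seteqP; split=> x /=; rewrite !in_itv/=.
    by move=> /andP[ax xb]; split=> //; apply/negP; rewrite -ltNge.
  by move=> [-> /negP]; rewrite -ltNge => ->.
have -> : `]-oo, a]%classic = (`]-oo, b] `&` `]-oo, a])%classic :> set R.
  by rewrite setIidr//; apply: subset_itvl; rewrite bnd_simp.
rewrite setDIr setDv set0U measureD//.
by rewrite (le_lt_trans _ moo)// le_measure ?inE//; exact: measurableT.
Qed.

(** Finiteness lets the values on rays be subtracted, which gives the values on half-open intervals.
    These are stable under intersection, generate the Borel sets, and exhaust the line through ]-n,
    n]. *)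
Lemma ray_measure_unique (m1 m2 : {measure set mR -> \bar R}) :
  m1 setT < +oo -> m2 setT < +oo ->
  (forall x : R, m1 `]-oo, x]%classic = m2 `]-oo, x]%classic) ->
  forall A, measurable A -> m1 A = m2 A.
Proof.
move=> m1oo m2oo m12 A mA; refine (@measure_unique _ R mR (@ocitv R)
  (fun n : nat => `](- n%:R)%R, n%:R%R]%classic : set R) erefl (@ocitvI R) _ _
    m1 m2 _ _ A mA) => //.
- by move=> n; exact: is_ocitv.
- apply/seteqP; split=> // x _; exists (Num.truncn `|x|).+1 => //=.
  have := truncnS_gt `|x|; rewrite ltr_norml => /andP[h1 h2].
  by rewrite in_itv/= h1 ltW.
- move=> _ [[a b] _ <-] /=.
  have [ab|ba] := leP a b; first by rewrite !measure_oc_itv// !m12.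
  by rewrite set_itv_ge ?measure0// bnd_simp -leNgt ltW.
- by move=> k; rewrite (le_lt_trans _ m1oo)// le_measure ?inE.
Qed.

Lemma uniform_probE (A : set mR) : measurable A ->
  U A = lebesgue_measure (A `&` `[0%R, 1%R]).
Proof.
move=> mA; rewrite /uniform_prob integral_uniform_pdf.
rewrite (eq_integral (fun=> 1)); last first.
  by move=> x; rewrite inE => -[_]; rewrite /= in_itv/= /uniform_pdf => ->;
    rewrite subr0 invr1.
by rewrite integral_cst ?mul1e//; exact: measurableI.
Qed.

Lemma uniform_lty : U setT < +oo.
Proof. by rewrite (@probability_setT _ _ _ U) ltry. Qed.

(** The distribution function of the uniform law, see [uniform_ray]. *)
Definition clamp01 (x : R) : R :=
  if (x < 0)%R then 0%R else if (x < 1)%R then x else 1%R.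

Lemma clamp01_lt0 x : (x < 0)%R -> clamp01 x = 0%R.
Proof. by rewrite /clamp01 => ->. Qed.

Lemma clamp01_id x : (0 <= x <= 1)%R -> clamp01 x = x.
Proof.
rewrite /clamp01 => /andP[x0 x1]; rewrite ltNge x0/=; case: ltP => // x1'.
by apply/le_anti; rewrite x1 x1'.
Qed.

Lemma clamp01_gt1 x : (1 < x)%R -> clamp01 x = 1%R.
Proof.
by move=> x1; rewrite /clamp01 !ltNge (ltW x1) (le_trans ler01 (ltW x1)).
Qed.

Lemma uniform_ray (x : R) : U `]-oo, x]%classic = (clamp01 x)%:E.
Proof.
rewrite uniform_probE// -set_itvI/=.
rewrite lebesgue_measure_itv/= /clamp01 oppr0 adde0 lte_fin meetEtotal.
rewrite (fun_if EFin) (fun_if EFin) /Order.min.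
case: (ltP x 1%R) => ?; case: (ltP x 0%R) => ?; case: ltP => ? //=; congr EFin;
  lra.
Qed.

Lemma uniform_oc_itv (a b : R) : (a <= b)%R ->
  U `]a, b]%classic = (clamp01 b - clamp01 a)%:E.
Proof.
move=> ab; have := @measure_oc_itv U a b uniform_lty ab.
by move=> /= ->; rewrite !uniform_ray.
Qed.

Lemma clamp01_ge0 x : (0 <= clamp01 x)%R.
Proof. by rewrite /clamp01; case: ltP => // x0; case: ifP. Qed.

Lemma clamp01_le1 x : (clamp01 x <= 1)%R.
Proof. by rewrite /clamp01; case: ltP => // x0; case: ltP => // /ltW. Qed.

(** The first binary digit; [doubling] shifts the digits. The strict inequality expands 1/2 as
    0.0111..., in agreement with [doubling] sending 1/2 to 1. *)
Definition upper_half (x : R) : bool := (2^-1 < x)%R.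

Definition doubling (x : mR) : mR := (2 * x - (upper_half x)%:R)%R.

Lemma measurable_upper_half p : measurable [set x : mR | upper_half x = p].
Proof.
have -> : [set x : mR | upper_half x = p] =
    (if p then `]2^-1%R, +oo[ else `]-oo, 2^-1%R])%classic.
  apply/seteqP; rewrite /upper_half; split=> x /=; case: p => /=;
    rewrite in_itv/= ?andbT// leNgt.
  - by move=> ->.
  - by move/negbTE.
by case: p; exact: measurable_itv.
Qed.

Lemma measurable_doubling : measurable_fun [set: mR] doubling.
Proof.
rewrite (_ : doubling = fun x : mR =>
    if upper_half x then (2 * x - 1)%R else (2 * x)%R); last first.
  by apply/funext => x; rewrite /doubling; case: ifP => //= _; rewrite subr0.
apply: measurable_fun_ifT.
- apply: (measurable_fun_bool true); rewrite setTI;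
    exact: (measurable_upper_half true).
- apply: measurable_funD => //; exact: measurable_funM.
- exact: measurable_funM.
Qed.

(** On each half of the unit interval [doubling] is affine with slope 2 and onto, up to an endpoint,
    so it doubles lengths. Comparing on rays is enough. *)
Lemma uniform_doubling_half p (C : set mR) : measurable C ->
  U (doubling @^-1` C `&` [set x | upper_half x = p]) = 2^-1%:E * U C.
Proof.
move=> mC; have mp := measurable_upper_half p.
have h0 : (0 <= 2^-1 :> R)%R by [].
apply: (ray_measure_unique (m1 := pushforward (mrestr U mp) doubling)
  (m2 := mscale (NngNum h0) U)) => //.
- exact: measurable_doubling.
- move=> mD; rewrite [X in X < _](_ : _ = U [set x | upper_half x = p]).
    by rewrite (le_lt_trans (probability_le1 _ mp))// ltry.
  by rewrite -[LHS]/(U (_ `&` _)) preimage_setT setTI.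
- rewrite -[X in X < _]/(2^-1%:E * U setT).
  by rewrite probability_setT mule1 ltry.
move=> mD s; rewrite -[LHS]/(U (_ `&` _)) -[RHS]/(2^-1%:E * U _) uniform_ray.
case: p mp mD => mp _.
- have -> : doubling @^-1` `]-oo, s]%classic `&` [set x | upper_half x = true]
      = `]2^-1%R, Num.max 2^-1%R ((s + 1) / 2)%R]%classic.
    apply/seteqP; split=> x /=; rewrite !in_itv/= /doubling /upper_half.
      by move=> [+ h]; rewrite h /= le_max => h1; apply/orP; right; lra.
    by move=> /andP[h]; rewrite h le_max => /orP[]/=; split=> //; lra.
  rewrite uniform_oc_itv ?le_max ?lexx// -EFinM; congr EFin.
  have [s0|s0] := ltP s 0%R.
    by rewrite max_l ?subrr ?clamp01_lt0 ?mulr0//; lra.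
  rewrite max_r; last lra.
  have [s1|s1] := leP s 1%R; first by rewrite !clamp01_id; lra.
  by rewrite !(@clamp01_gt1 s) ?(@clamp01_gt1 ((s + 1) / 2)%R) ?clamp01_id; lra.
- have -> : doubling @^-1` `]-oo, s]%classic `&` [set x | upper_half x = false]
      = `]-oo, Num.min 2^-1%R (s / 2)%R]%classic.
    apply/seteqP; split=> x /=; rewrite !in_itv/= /doubling /upper_half.
      by move=> [+ h]; rewrite h /= le_min leNgt h/= => h1; lra.
    by rewrite le_min leNgt => /andP[/negbTE h h1]; rewrite h; split=> //=; lra.
  rewrite uniform_ray -EFinM; congr EFin.
  have [s0|s0] := ltP s 0%R.
    by rewrite min_r ?clamp01_lt0 ?mulr0//; lra.
  have [s1|s1] := leP s 1%R.
    by rewrite min_r ?clamp01_id; lra.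
  by rewrite min_l ?(@clamp01_gt1 s) ?clamp01_id; lra.
Qed.

(** Total probability over the first digit, which is fair and independent of the shifted number.
    Letting A depend on the digit is what [digits_cdf_rec] requires. *)
Lemma uniform_doubling (A : bool -> set mR) : (forall p, measurable (A p)) ->
  U [set x | A (upper_half x) (doubling x)] =
  2^-1%:E * (U (A false) + U (A true)).
Proof.
move=> mA.
have mAp p : measurable (doubling @^-1` A p `&` [set x | upper_half x = p]).
  apply: measurableI; last exact: measurable_upper_half.
  by rewrite -[X in measurable X]setTI; exact: measurable_doubling.
rewrite ge0_muleDr// -(uniform_doubling_half false)// -(uniform_doubling_half
  true)// -measureU//.
  congr (U _); apply/seteqP; split=> x /=.
    by case: (upper_half x) => ?; [right|left].
  by case=> -[Ax ->].
by apply/seteqP; split=> // x [[_ /= ->] [_ /=]].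
Qed.

End uniform_on_unit_interval.

(** * Independence of the digits of even and odd rank *)

Section even_binary_digits.
Context {R : realType}.
Local Notation mR := (measurableTypeR R).
Local Notation U := (uniform_prob (@ltr01 R)).

(** Each step reads one digit and skips the next, so ranks count from 0. The value is the sum over k
    < n of digit 2k of x divided by 2^(k+1). *)
Fixpoint even_digits_approx (n : nat) (x : mR) : R :=
  if n is m.+1 then
    ((upper_half x)%:R + even_digits_approx m (doubling (doubling x))) / 2
  else 0.

(* The number whose binary digits are the digits of even rank of [x]. *)
Definition even_digits (x : mR) : mR :=
  lim (even_digits_approx ^~ x @ \oo).

Lemma even_digits_approx_itv n x : 0 <= even_digits_approx n x <= 1.
Proof.
elim: n x => [|n IHn] x /=; first by rewrite lexx ler01.
move: (IHn (doubling (doubling x))); move: (even_digits_approx n _) => y.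
have : 0 <= ((upper_half x)%:R : R) <= 1.
  by rewrite ler0n lern1 leq_b1.
by move: ((upper_half x)%:R : R) => z /andP[z0 z1] /andP[y0 y1]; apply/andP;
  split; lra.
Qed.

Lemma even_digits_approx_cvg x :
  even_digits_approx n x @[n --> \oo] --> (even_digits x : R).
Proof.
apply: nondecreasing_is_cvgn.
  apply/nondecreasing_seqP => n; elim: n x => [|n IHn] x.
    by have /andP[] := even_digits_approx_itv 1 x.
  by rewrite /= ler_pM2r ?invr_gt0// lerD2l; exact: IHn.
by exists 1 => _ [n _ <-]; have /andP[] := even_digits_approx_itv n x.
Qed.

Lemma even_digits_rec x : even_digits x =
  ((upper_half x)%:R + (even_digits (doubling (doubling x)) : R)) / 2 :> R.
Proof.
have h1 := @even_digits_approx_cvg x.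
have h2 := @even_digits_approx_cvg (doubling (doubling x)).
move: h1; rewrite -cvg_shiftS /= => h1.
apply: (cvg_unique _ h1) => //; apply: cvgM; last exact: cvg_cst.
by apply: cvgD; [exact: cvg_cst|exact: h2].
Qed.

Lemma even_digits_itv x : 0 <= (even_digits x : R) <= 1.
Proof.
have h := @even_digits_approx_cvg x.
apply/andP; split.
  apply: (cvgr_to_ge h); near=> n.
  by have /andP[] := even_digits_approx_itv n x.
apply: (cvgr_to_le h); near=> n.
by have /andP[] := even_digits_approx_itv n x.
Unshelve. all: by end_near. Qed.

Lemma measurable_even_digits : measurable_fun [set: mR] even_digits.
Proof.
apply: (@measurable_fun_cvg _ _ R setT even_digits_approx); last first.
  by move=> x _; exact: even_digits_approx_cvg.
elim=> [|n IHn] /=; first exact: measurable_cst.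
apply: measurable_funM => //; apply: measurable_funD.
  apply: (@measurableT_comp _ _ _ _ _ _ (fun b : bool => b%:R : R)) => //.
  apply: (measurable_fun_bool true); rewrite setTI.
  exact: (measurable_upper_half true).
by apply: measurableT_comp IHn _; apply: measurableT_comp;
  exact: measurable_doubling.
Qed.

Local Notation odd_digits := (even_digits \o doubling).

Lemma measurable_odd_digits : measurable_fun [set: mR] odd_digits.
Proof.
exact: measurableT_comp measurable_even_digits measurable_doubling.
Qed.

Definition digits_cdf (s t : R) : R :=
  fine (U (even_digits @^-1` `]-oo, s]%classic `&`
           odd_digits @^-1` `]-oo, t]%classic)).

Lemma measurable_digits_ray s t : measurable
  (even_digits @^-1` `]-oo, s]%classic `&` odd_digits @^-1` `]-oo, t]%classic
    : set mR).
Proof.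
apply: measurableI; apply: measurable_preimageT.
- exact: measurable_even_digits.
- exact: measurable_itv.
- exact: measurable_odd_digits.
- exact: measurable_itv.
Qed.

(** Shifting by one digit exchanges the roles: the odd digits of x are the even digits of
    [doubling x], while the even digits of x are its first digit p followed by the odd digits of
    [doubling x]. Hence s becomes 2 s - p and the arguments are swapped. *)
Lemma digits_cdf_rec s t :
  digits_cdf s t = 2^-1 * (digits_cdf t (2 * s) + digits_cdf t (2 * s - 1)).
Proof.
pose A p : set mR := (even_digits @^-1` `]-oo, t]%classic `&`
  odd_digits @^-1` `]-oo, (2 * s - p%:R)%R]%classic).
have mA p : measurable (A p) by exact: measurable_digits_ray.
have := @uniform_doubling R A mA.
rewrite (_ : [set x | _] = even_digits @^-1` `]-oo, s]%classic `&`
  odd_digits @^-1` `]-oo, t]%classic); last first.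
  apply/seteqP; split=> x; rewrite /A /= !in_itv/= (even_digits_rec x);
    move: ((upper_half x)%:R : R) (even_digits (doubling (doubling x)) : R) =>
      b y.
    by move=> [-> h]; split=> //; lra.
  by move=> [h ->]; split=> //; lra.
rewrite /digits_cdf => ->.
have fA p : U (A p) \is a fin_num by exact: fin_num_measure.
have E0 : 2 * s - false%:R = 2 * s by rewrite mulr0n subr0.
by rewrite -(fineK (fA false)) -(fineK (fA true)) -EFinD -EFinM /= /A E0.
Qed.

Lemma digits_cdf_itv s t : 0 <= digits_cdf s t <= 1.
Proof.
have m := measurable_digits_ray s t.
by rewrite /digits_cdf -!lee_fin !fineK ?fin_num_measure// measure_ge0
  probability_le1.
Qed.

Lemma digits_cdf_lt0l s t : s < 0 -> digits_cdf s t = 0.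
Proof.
move=> s0; rewrite /digits_cdf (_ : _ `&` _ = set0) ?measure0//.
apply/seteqP; split=> // x [+ _]; rewrite /= in_itv/= leNgt => /negP[].
by apply: lt_le_trans s0 _; case/andP: (even_digits_itv x).
Qed.

Lemma digits_cdf_lt0r s t : t < 0 -> digits_cdf s t = 0.
Proof.
move=> t0; rewrite /digits_cdf (_ : _ `&` _ = set0) ?measure0//.
apply/seteqP; split=> // x [_]; rewrite /= in_itv/= leNgt => /negP[].
by apply: lt_le_trans t0 _; case/andP: (even_digits_itv (doubling x)).
Qed.

Lemma even_digits_ge1 s : 1 <= s -> even_digits @^-1` `]-oo, s]%classic = setT.
Proof.
move=> s1; apply/seteqP; split=> // x _ /=; rewrite in_itv/= (le_trans _ s1)//.
by case/andP: (even_digits_itv x).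
Qed.

Lemma digits_cdf_ge1l s t : 1 <= s -> digits_cdf s t = digits_cdf 1 t.
Proof.
move=> s1.
by rewrite /digits_cdf (even_digits_ge1 s1) (even_digits_ge1 (lexx 1)).
Qed.

Lemma odd_digits_preimage (A : set mR) :
  odd_digits @^-1` A = doubling @^-1` (even_digits @^-1` A).
Proof. by []. Qed.

Lemma digits_cdf_ge1r s t : 1 <= t -> digits_cdf s t = digits_cdf s 1.
Proof.
move=> t1; rewrite /digits_cdf !odd_digits_preimage.
by rewrite (even_digits_ge1 t1) (even_digits_ge1 (lexx 1)).
Qed.

Lemma digits_cdf11 : digits_cdf 1 1 = 1.
Proof.
rewrite /digits_cdf odd_digits_preimage (even_digits_ge1 (lexx 1)).
by rewrite preimage_setT setTI probability_setT.
Qed.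

(** At s = 1 both 2 s and 2 s - 1 are at least 1, so one step of the recursion identifies the two
    marginals. *)
Lemma digits_cdf1 t : digits_cdf 1 t = digits_cdf t 1.
Proof.
by rewrite digits_cdf_rec !(@digits_cdf_ge1r t) ?lexx//; lra.
Qed.

Lemma eq0_le_geometric (x : R) : (forall n, `|x| <= 2^-1 ^+ n) -> x = 0.
Proof.
move=> xn; apply/eqP; rewrite -normr_le0.
have h : (2^-1 : R) ^+ n @[n --> \oo] --> 0.
  by apply: cvg_expr; rewrite ger0_norm; lra.
by apply: (cvgr_to_ge h); near=> n; exact: xn.
Unshelve. all: by end_near. Qed.

(** By [digits_cdf_rec] and [digits_cdf1] the marginal [digits_cdf s 1] obeys the same recursion, so
    the difference of the two functions contracts. *)
Lemma clamp01_rec (s : R) :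
  clamp01 s = 2^-1 * (clamp01 (2 * s) + clamp01 (2 * s - 1)).
Proof.
have [s0|s0] := ltP s 0; first by rewrite !clamp01_lt0; lra.
have [s1|s1] := ltP 1 s; first by rewrite !clamp01_gt1; lra.
have [s2|s2] := ltP s 2^-1.
  by rewrite (@clamp01_lt0 _ (2 * s - 1)) ?clamp01_id; lra.
rewrite (@clamp01_id _ s) ?(@clamp01_id _ (2 * s - 1)); try lra.
have [->|s3] := eqVneq s 2^-1; first by rewrite clamp01_id; lra.
by rewrite clamp01_gt1; lra.
Qed.

Lemma clamp01_ge1 (s : R) : 1 <= s -> clamp01 s = 1.
Proof.
rewrite le_eqVlt => /orP[/eqP<-|/clamp01_gt1//].
by rewrite clamp01_id// ler01 lexx.
Qed.

(** If s < 1/2 both functions vanish at 2 s - 1, otherwise both equal 1 at 2 s. Only one term of the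
    recursion carries an error, and that error is halved. *)
Lemma digits_cdf_marginal s : digits_cdf s 1 = clamp01 s.
Proof.
apply/eqP; rewrite -subr_eq0; apply/eqP/eq0_le_geometric => n.
elim: n s => [|n IHn] s.
  have /andP[] := digits_cdf_itv s 1; have := clamp01_ge0 s.
  have := clamp01_le1 s; rewrite expr0 ler_norml.
  by move: (clamp01 s) (digits_cdf s 1) => p q ? ? ? ?; apply/andP; split; lra.
rewrite digits_cdf_rec !digits_cdf1 (clamp01_rec s) exprS.
have h : forall a b c : R, `|a| <= b -> c = 2^-1 * a -> `|c| <= 2^-1 * b.
  by move=> a b c ab ->; rewrite normrM ger0_norm ?ler_wpM2l.
have [s2|s2] := ltP s 2^-1.
  apply: h (IHn (2 * s)) _.
  by rewrite (@digits_cdf_lt0l (2 * s - 1)) ?(@clamp01_lt0 _ (2 * s - 1)); lra.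
apply: h (IHn (2 * s - 1)) _.
rewrite (@digits_cdf_ge1l (2 * s)) ?digits_cdf11 ?(@clamp01_ge1 (2 * s)); lra.
Qed.

(* The recursion halves the distance to the product of the marginals: one of
   its two terms is always at a point where the two are known to agree. *)
Lemma digits_cdfE s t : digits_cdf s t = clamp01 s * clamp01 t.
Proof.
apply/eqP; rewrite -subr_eq0; apply/eqP/eq0_le_geometric => n.
elim: n s t => [|n IHn] s t.
  have /andP[h1 h2] := digits_cdf_itv s t.
  have := mulr_ge0 (clamp01_ge0 s) (clamp01_ge0 t).
  have := mulr_ile1 (clamp01_ge0 s) (clamp01_ge0 t) (clamp01_le1 s)
    (clamp01_le1 t).
  rewrite expr0 ler_norml; move: (clamp01 s * _) (digits_cdf s t) h1 h2.
  by move=> p q ? ? ? ?; apply/andP; split; lra.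
rewrite digits_cdf_rec (clamp01_rec s) exprS.
have h : forall a b c : R, `|a| <= b -> c = 2^-1 * a -> `|c| <= 2^-1 * b.
  by move=> a b c ab ->; rewrite normrM ger0_norm ?ler_wpM2l.
have [s2|s2] := ltP s 2^-1.
  apply: h (IHn t (2 * s)) _.
  by rewrite (@digits_cdf_lt0r _ (2 * s - 1)) ?(@clamp01_lt0 _ (2 * s - 1));
    [ring|lra|lra].
apply: h (IHn t (2 * s - 1)) _.
rewrite (@digits_cdf_ge1r _ (2 * s)) ?digits_cdf_marginal ?(@clamp01_ge1 (2 *
  s));
  [ring|lra|lra].
Qed.

(** The product formula on pairs of rays is extended one coordinate at a time, applying
    [ray_measure_unique] to the image of U restricted to an event of the other coordinate. *)
Lemma digits_independent (A C : set mR) : measurable A -> measurable C ->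
  U (even_digits @^-1` A `&` odd_digits @^-1` C) = (U A * U C)%E.
Proof.
have rfin (B : set mR) : measurable B -> (0 <= fine (U B))%R.
  by move=> mB; rewrite fine_ge0.
have me := measurable_even_digits; have mo := measurable_odd_digits.
have U_le (B : set mR) : measurable B -> (U B < +oo)%E.
  by move=> mB; rewrite (le_lt_trans (probability_le1 _ mB))// ltry.
have step1 t (B : set mR) : measurable B ->
    U (even_digits @^-1` B `&` odd_digits @^-1` `]-oo, t]%classic) =
    ((clamp01 t)%:E * U B)%E.
  have mt : measurable (odd_digits @^-1` `]-oo, t]%classic : set mR).
    by apply: measurable_preimageT => //; exact: measurable_itv.
  apply: (ray_measure_unique (m1 := pushforward (mrestr U mt) even_digits)
    (m2 := mscale (NngNum (clamp01_ge0 t)) U)).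
  - rewrite -[X in (X < _)%E]/(U (_ `&` _)) U_le//.
    by apply: measurableI => //; exact: measurable_preimageT.
  - rewrite -[X in (X < _)%E]/((clamp01 t)%:E * U setT)%E.
    by rewrite probability_setT mule1 ltry.
  move=> s; rewrite -[LHS]/(U (_ `&` _)) -[RHS]/((clamp01 t)%:E * U _)%E.
  rewrite uniform_ray -EFinM mulrC -digits_cdfE fineK// fin_num_measure//.
  exact: measurable_digits_ray.
move=> mA; move: C.
have mA' : measurable (even_digits @^-1` A : set mR).
  exact: measurable_preimageT.
have UA0 := rfin A mA.
have UAE : U A = (fine (U A))%:E by rewrite fineK// fin_num_measure.
move=> C mC; rewrite setIC UAE; move: C mC.
apply: (ray_measure_unique (m1 := pushforward (mrestr U mA') odd_digits)
  (m2 := mscale (NngNum UA0) U)).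
- rewrite -[X in (X < _)%E]/(U (_ `&` _)) U_le//.
  by apply: measurableI => //; exact: measurable_preimageT.
- rewrite -[X in (X < _)%E]/((fine (U A))%:E * U setT)%E.
  by rewrite probability_setT mule1 ltry.
move=> s; rewrite -[LHS]/(U (_ `&` _)) -[RHS]/((fine (U A))%:E * U _)%E.
by rewrite -UAE setIC step1// uniform_ray muleC.
Qed.

Lemma even_digits_uniform (A : set mR) : measurable A ->
  U (even_digits @^-1` A) = U A.
Proof.
move=> mA; have := digits_independent mA (@measurableT _ mR).
by rewrite preimage_setT setIT probability_setT mule1.
Qed.

End even_binary_digits.

(** * The quantile transform *)

Section quantile.
Context {R : realType}.
Local Notation mR := (measurableTypeR R).
Local Notation U := (uniform_prob (@ltr01 R)).
Variable mu : probability mR R.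

(** Seen as a random variable under [mu], the identity has [Phi] as its distribution function, so
    results on [cdf] apply to [Phi]. *)
Let idR : mR -> R := idfun.
#[local] HB.instance Definition _ :=
  @isMeasurableFun.Build _ _ mR R idR (@measurable_id _ mR setT).

Let Phi (x : R) : R := fine (mu `]-oo, x]%classic).

Let PhiE x : (Phi x)%:E = mu `]-oo, x]%classic.
Proof. by rewrite fineK// fin_num_measure//; exact: measurable_itv. Qed.

Let Phi_cdf x : (Phi x)%:E = cdf (P := mu) (idR : {RV mu >-> R}) x.
Proof. exact: PhiE. Qed.

Let Phi_nd x y : x <= y -> Phi x <= Phi y.
Proof. by move=> xy; rewrite -lee_fin !Phi_cdf cdf_nondecreasing. Qed.

Let Phi_itv x : 0 <= Phi x <= 1.
Proof. by rewrite -!lee_fin Phi_cdf cdf_ge0 cdf_le1. Qed.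

Definition quantile (p : mR) : mR :=
  inf [set x : R | p <= fine (mu `]-oo, x]%classic)].

(** For 0 < p < 1 the limits of [Phi] at both infinities make the defining set nonempty and bounded
    below. Right continuity gives the direct implication: if [Phi x] < p, then [Phi] stays below p
    slightly to the right of x, which pushes the infimum beyond x. *)
Let quantile_le p x : 0 < (p : R) < 1 -> ((quantile p : R) <= x) = (p <= Phi x).
Proof.
move=> /andP[p0 p1].
have [y py] : exists y, Phi y < p.
  have /fine_cvgP[_ /cvgr_lt/(_ _ p0)] :=
    cvg_cdfNy0 (P := mu) (idR : {RV mu >-> R}).
  exact: filter_ex.
have [z pz] : exists z, p < Phi z.
  have /fine_cvgP[_ /cvgr_gt/(_ _ p1)] :=
    cvg_cdfy1 (P := mu) (idR : {RV mu >-> R}).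
  exact: filter_ex.
have lb : lbound [set x : R | p <= Phi x] y.
  move=> w /= pw; rewrite leNgt; apply/negP => /ltW/Phi_nd yw.
  by have := lt_le_trans py (le_trans pw yw); rewrite ltxx.
apply/idP/idP => [qx|px]; last by apply: ge_inf => //; exists y.
rewrite leNgt; apply/negP => Phixp.
have : Phi w @[w --> x^'+] --> Phi x.
  have := cdf_right_continuous (X := (idR : {RV mu >-> R})) (x := x).
  by rewrite -Phi_cdf => /fine_cvgP[_].
move=> /cvgr_lt/(_ _ Phixp) Phip.
have [w [Phiw xw]] : exists w, Phi w < p /\ x < w.
  apply: (@filter_ex _ x^'+); apply: filterI; first exact: Phip.
  exact: nbhs_right_gt.
have : w <= quantile p.
  apply: lb_le_inf; first by exists z => /=; exact: ltW.
  move=> v /= pv; rewrite leNgt; apply/negP => /ltW/Phi_nd vw.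
  by have := lt_le_trans Phiw (le_trans pv vw); rewrite ltxx.
by move=> /le_trans/(_ qx); rewrite leNgt xw.
Qed.

Let uniform_open01 (A : set mR) : measurable A -> U A = U (A `&` `]0,
  1[%classic).
Proof.
move=> mA; rewrite !uniform_probE//; last exact: measurableI.
rewrite -setIA (_ : `]0, 1[%classic `&` `[0, 1]%classic = `]0, 1[%classic);
  last first.
  by rewrite setIidl//; exact: subset_itv_oo_cc.
have -> : A `&` `[0, 1]%classic =
    (A `&` `]0, 1[%classic) `|` (A `&` [set 0; 1]) :> set mR.
  rewrite -setIUr; congr (_ `&` _); apply/seteqP; split=> x /=;
    rewrite !in_itv/=.
    rewrite !le_eqVlt => /andP[/orP[/eqP<-|x0]]; first by right; left.
    by move=> /orP[/eqP->|x1]; [right; right|left; rewrite x0 x1].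
  by move=> [/andP[/ltW-> /ltW->//]|[->|->]]; rewrite ?lexx ?ler01.
have m2 : measurable (A `&` [set 0; 1] : set mR).
  by apply: measurableI => //; apply: measurableU; exact: measurable_set1.
rewrite measureU0//; first exact: measurableI.
have c2 : countable [set 0; 1 : R] by exact/finite_set_countable/finite_set2.
apply: (subset_measure0 m2 _ (@subIsetr _ A _)).
  by apply: measurableU; exact: measurable_set1.
exact: countable_lebesgue_measure0.
Qed.

(** The complement of ]0, 1[ is null for U; a constant value there keeps the preimages of rays
    explicit, hence measurable. *)
Definition quantile01 (p : mR) : mR :=
  if 0 < (p : R) < 1 then quantile p else 0.

Let quantile01_ray x : quantile01 @^-1` `]-oo, x]%classic =
  `]0, 1[%classic `&` `]-oo, Phi x]%classic `|` (~` `]0, 1[%classic `&` (if 0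
    <= x then setT else set0)).
Proof.
apply/seteqP; split=> p; rewrite /quantile01 /= !in_itv/=.
  case: ifPn => p01; first by rewrite quantile_le//; left.
  by move=> ->; right; split=> //; exact/negP.
case=> -[+ h]; first by move=> p01; rewrite p01 quantile_le.
by move=> /negP/negbTE ->; case: ifP h.
Qed.

Lemma measurable_quantile01 : measurable_fun [set: mR] quantile01.
Proof.
apply: (@measurability _ _ _ _ _ _ _ (RGenOInfty.measurableE R)).
move=> _ [_ [x ->] <-]; rewrite setTI.
rewrite [X in measurable X](_ : _ = ~` (quantile01 @^-1` `]-oo, x]%classic)).
  rewrite quantile01_ray.
  apply: measurableC; apply: measurableU; apply: measurableI => //.
    by apply: measurableC; exact: measurable_itv.
  by case: ifP.
by apply/seteqP; split=> p /=; rewrite !in_itv/= andbT ltNge => /negP.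
Qed.

(** Inverse transform sampling: inside ]0, 1[ the preimage of the ray up to x is the ray up to
    [Phi x], whose uniform measure is [Phi x]. *)
Lemma quantile01_uniform (A : set mR) : measurable A ->
  U (quantile01 @^-1` A) = mu A.
Proof.
apply: (ray_measure_unique (m1 := pushforward U quantile01) (m2 := mu)).
- exact: measurable_quantile01.
- move=> mq; exact: uniform_lty.
- by rewrite -ge0_fin_numE//; exact: fin_num_measure.
move=> mq x; rewrite -[LHS]/(U (_ @^-1` _)) uniform_open01; last first.
  by rewrite -[X in measurable X]setTI; exact: measurable_quantile01.
rewrite quantile01_ray setIUl.
rewrite [X in _ `|` X](_ : _ = set0) ?setU0; last first.
  by apply/seteqP; split=> // p [[]].
rewrite setIAC setIid setIC -uniform_open01//.
by rewrite uniform_ray clamp01_id// PhiE.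
Qed.

End quantile.

(** * Scaling and first moment of the normal law *)

Section normal_scaling.
Context {R : realType}.
Local Notation mR := (measurableTypeR R).
Local Open Scope ereal_scope.

Lemma normal_pdf_scale (s x : R) : (0 < s)%R ->
  (normal_pdf 0 s (s * x) * s)%R = normal_pdf 0 1 x.
Proof.
move=> s0; rewrite !normal_pdfE ?gt_eqF// /normal_peak /normal_fun !subr0.
have -> : (- (s * x) ^+ 2 / (s ^+ 2 *+ 2) = - x ^+ 2 / (1 ^+ 2 *+ 2))%R.
  have sn0 : (s != 0)%R by rewrite gt_eqF.
  by rewrite -(mulr_natr (s ^+ 2)) -(mulr_natr (1 ^+ 2)); field.
rewrite -!mulrnAr !(sqrtrM _ (sqr_ge0 _)) !sqrtr_sqr gtr0_norm// normr1 mul1r.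
rewrite mulrAC; congr (_ * _)%R.
by rewrite invfM mulrAC mulVf ?mul1r// gt_eqF.
Qed.

(** Checked on rays by the substitution z |-> s z in the integral of the density. It puts the law of
    a multiple of a standard normal variable in the form used by [gaussian_law]. *)
Lemma normal_prob_scale (s : R) (A : set mR) : (0 < s)%R -> measurable A ->
  normal_prob 0 1 ((fun x : mR => (s * x)%R : mR) @^-1` A) = normal_prob 0 s A.
Proof.
move=> s0.
have ms : measurable_fun [set: mR] (fun x : mR => (s * x)%R : mR).
  exact: measurable_funM.
apply: (ray_measure_unique
  (m1 := pushforward (normal_prob 0 1) (fun x : mR => (s * x)%R : mR))
  (m2 := normal_prob 0 s)).
- rewrite -[X in X < _]/(normal_prob 0 1 setT) -ge0_fin_numE//;
    exact: fin_num_measure.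
- by rewrite -ge0_fin_numE//; exact: fin_num_measure.
move=> x; rewrite -[LHS]/(normal_prob 0 1 (_ @^-1` _)).
have -> : (fun x : mR => (s * x)%R : mR) @^-1` `]-oo, x]%classic =
    `]-oo, (x / s)%R]%classic.
  by apply/seteqP; split=> y /=; rewrite !in_itv/= ler_pdivlMr// mulrC.
rewrite /normal_prob.
set y := (x / s)%R; have -> : x = (s * y)%R by rewrite mulrC divfK// gt_eqF.
have dF (z : R) : is_derive (z : R^o) (1 : R^o)%R ( *%R s : R^o -> R^o) s.
  have : is_derive (z : R^o) (1 : R^o)%R ((s : R) *: (id : R^o -> R^o))%R s.
    by apply: is_derive_eq; rewrite scaler1.
  by [].
have F'E : ( *%R s : R^o -> R^o)^`()%classic = cst s.
  by apply/funext => z; rewrite derive1E; apply: derive_val; exact: dF.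
have F'cst (F : set_system R) : Filter F -> ( *%R s : R^o -> R^o)^`()%classic z
  @[z --> F] --> s.
  by move=> FF; rewrite F'E; exact: cvg_cst.
have s1 : s != 0%R by rewrite gt_eqF.
refine (etrans _ (esym (@increasing_ge0_integration_by_substitutionNy R ( *%R s)
  (normal_pdf 0 s) y _ _ _ _ _ _ _ _))).
- apply: eq_integral => z _; rewrite -(normal_pdf_scale z s0); congr EFin.
  by rewrite F'E.
- by move=> a b _ _; rewrite ltr_pM2l.
- by move=> z _; rewrite F'E; exact: cvg_cst.
- by apply/cvg_ex; exists s; exact: F'cst.
- by rewrite {2}F'E; exact: F'cst.
- split; first by move=> z _; exact: ex_derive.
  by apply: cvg_at_left_filter; exact: mulrl_continuous.
- by apply: gt0_cvgMrNy.
- by apply: continuous_subspaceT; exact: continuous_normal_pdf.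
- by move=> z _; exact: normal_pdf_ge0.
Qed.

(** An integrable majorant for the first moment. Since exp(-x^2/2) = exp(-x^2/8) exp(-3x^2/8) and
    exp y >= 1 + y, the product |x| exp(-3x^2/8) is at most 2; the other factor 2 is the ratio of
    the peaks for deviations 1 and 2. *)
Lemma abs_normal_pdf_le (x : R) :
  (`|x| * normal_pdf 0 1 x <= 4 * normal_pdf 0 2 x)%R.
Proof.
have -> : (normal_pdf 0 2 x = 2^-1 * normal_pdf 0 1 (x / 2))%R.
  rewrite -(@normal_pdf_scale 2%R (x / 2)%R)// mulrC mulfK//.
  by rewrite mulrC divfK.
rewrite !normal_pdfE// /normal_fun !subr0 expr1n.
have -> : (- x ^+ 2 / 2 = - (x / 2) ^+ 2 / 2 + - (3 / 8 * x ^+ 2))%R.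
  by field.
rewrite expRD expRN.
have := expR_ge1Dx (3 / 8 * x ^+ 2)%R.
have := expR_gt0 (3 / 8 * x ^+ 2)%R.
have := expR_ge0 (- (x / 2) ^+ 2 / 2)%R.
have := normal_peak_ge0 (1 : R)%R.
move: (normal_peak _) (expR (3 / 8 * _)) (expR _) => p E F p0 F0 E0 E1.
have xE : (`|x| / E <= 2)%R.
  rewrite ler_pdivrMr//; move: E1; rewrite -(real_normK (num_real x)).
  by move: `|x|%R => y E1; have := sqr_ge0 (y - 4 / 3)%R; nra.
rewrite [leLHS](_ : _ = p * F * (`|x| / E))%R; last by ring.
rewrite [leRHS](_ : _ = p * F * 2)%R; last by field.
by rewrite ler_wpM2l// mulr_ge0.
Qed.

(** The Radon-Nikodym derivative and the explicit density have the same integral over every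
    measurable set, so they agree almost everywhere. *)
Lemma ge0_integral_normal_prob (f : mR -> \bar R) :
  measurable_fun setT f -> (forall x, 0 <= f x) ->
  \int[normal_prob 0 1]_x f x =
  \int[lebesgue_measure]_x (f x * (normal_pdf 0 1 x)%:E).
Proof.
move=> mf f0.
rewrite -(Radon_Nikodym_SigmaFinite.change_of_variables
  (normal_prob_dominates 0 1))//.
have fi := Radon_Nikodym_SigmaFinite.f_integrable
  (@normal_prob_dominates R 0 1).
apply: ae_eq_integral => //.
- by apply: emeasurable_funM => //; exact: measurable_int fi.
- by apply: emeasurable_funM => //; apply/measurable_EFinP;
    exact: measurable_normal_pdf.
- apply: ae_eqe_mul2l; apply: integral_ae_eq => //.
  + by apply/measurable_EFinP; exact: measurable_normal_pdf.
  + move=> E _ mE; rewrite -Radon_Nikodym_SigmaFinite.f_integral//.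
    exact: normal_prob_dominates.
Qed.

Lemma normal_prob_integrable_id :
  (normal_prob (0:R)%R 1%R).-integrable setT (fun x : mR => (x : R)%:E).
Proof.
apply/integrableP; split; first exact/measurable_EFinP.
have mabs : measurable_fun [set: mR] (fun x : mR => `|(x : R)%:E|).
  by apply: measurableT_comp => //; exact/measurable_EFinP.
rewrite ge0_integral_normal_prob//.
apply: (@le_lt_trans _ _
    (\int[lebesgue_measure]_x ((4%R : R)%:E * (normal_pdf 0 2 x)%:E)));
      last first.
  rewrite integralZl//; last exact: integrable_normal_pdf.
  by rewrite integral_normal_pdf mule1 ltry.
apply: ge0_le_integral => //.
- by move=> x _; rewrite mule_ge0// lee_fin normal_pdf_ge0.
- apply: emeasurable_funM; last by apply/measurable_EFinP;
    exact: measurable_normal_pdf.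
  exact: mabs.
- apply: emeasurable_funM => //.
  by apply/measurable_EFinP; exact: measurable_normal_pdf.
move=> x _; rewrite abse_EFin -!EFinM lee_fin; exact: abs_normal_pdf_le.
Qed.

End normal_scaling.

(** * An independent sequence with a given law *)

Section iid_sequence.
Context {R : realType}.
Local Notation mR := (measurableTypeR R).
Local Notation U := (uniform_prob (@ltr01 R)).
Variable mu : probability mR R.

(** At each rank the even digits of the current number feed the variable and the odd digits are kept
    for all later ranks. *)
Definition iid_seq (n : nat) (x : mR) : R :=
  quantile01 mu (even_digits (iter n (even_digits \o doubling) x)).

Let preimage_measurable (f : mR -> mR) (B : set R) :
  measurable_fun [set: mR] f -> measurable B -> measurable (f @^-1` B : set mR).
Proof. exact: measurable_preimageT. Qed.

Lemma measurable_iid_seq n : measurable_fun [set: mR] (iid_seq n).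
Proof.
apply: (measurableT_comp (measurable_quantile01 mu)).
apply: (measurableT_comp (@measurable_even_digits R)).
elim: n => [|n IHn]; first exact: measurable_id.
exact: (measurableT_comp (@measurable_odd_digits R) IHn).
Qed.

Let iid_seqS n : iid_seq n.+1 = iid_seq n \o (even_digits \o doubling).
Proof. by apply/funext => x; rewrite /iid_seq iterSr. Qed.

Let odd_uniform (C : set mR) : measurable C ->
  U ((even_digits \o doubling) @^-1` C) = U C.
Proof.
move=> mC; have := digits_independent (@measurableT _ mR) mC.
by rewrite preimage_setT setTI probability_setT mul1e.
Qed.

(** The variable of rank 0 depends on the even digits only, and the later ones are the same sequence
    evaluated at the odd digits; [digits_independent] then peels off one factor. *)
Let joint n (B : nat -> set R) : (forall i, measurable (B i)) ->
  measurable (\big[setI/setT]_(i < n) (iid_seq i @^-1` B i) : set mR) /\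
  U (\big[setI/setT]_(i < n) (iid_seq i @^-1` B i)) = (\prod_(i < n) mu (B
    i))%E.
Proof.
elim: n B => [|n IHn] B mB.
  by rewrite !big_ord0 probability_setT; split.
have [mI UI] := IHn (fun i => B i.+1) (fun i => mB i.+1).
have E : \big[setI/setT]_(i < n.+1) (iid_seq i @^-1` B i) =
    even_digits @^-1` (quantile01 mu @^-1` B 0%N) `&`
    (even_digits \o doubling) @^-1`
      (\big[setI/setT]_(i < n) (iid_seq i @^-1` B i.+1)) :> set mR.
  rewrite big_ord_recl; congr (_ `&` _).
  rewrite (big_morph (fun A : set mR => (even_digits \o doubling) @^-1` A)
    (@preimage_setI _ _ _) (@preimage_setT _ _ _)).
  by apply: eq_bigr => i _; rewrite lift0 iid_seqS.
have mq : measurable (quantile01 mu @^-1` B 0%N : set mR).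
  by apply: preimage_measurable => //; exact: measurable_quantile01.
rewrite E; split.
  apply: measurableI; apply: preimage_measurable => //.
    exact: measurable_even_digits.
  exact: measurable_odd_digits.
rewrite digits_independent// UI quantile01_uniform; last exact: mB.
by rewrite [RHS]big_ord_recl.
Qed.

Lemma iid_seq_law n (B : set R) : measurable B ->
  pushforward U (iid_seq n) B = mu B.
Proof.
move=> mB; rewrite /pushforward; elim: n => [|n IHn].
  rewrite -quantile01_uniform// -[RHS]even_digits_uniform//.
  by apply: preimage_measurable => //; exact: measurable_quantile01.
rewrite iid_seqS comp_preimage odd_uniform//.
by apply: preimage_measurable => //; exact: measurable_iid_seq.
Qed.

Lemma iid_seq_independent : independent_sequence U iid_seq.
Proof.
move=> J B uJ mB.
pose n := (\max_(i <- J) i).+1.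
have Jn i : i \in J -> (i < n)%N.
  by move=> iJ; rewrite ltnS (big_rem i)//= leq_max leqnn.
(* Filling the missing ranks with the whole line reduces a finite set of indices to the initial
   segment treated by [joint]. *)
pose B' i := if i \in J then B i else setT.
have mB' i : measurable (B' i) by rewrite /B'; case: ifP.
have [_ UB'] := joint n mB'.
have perm : perm_eq J [seq i <- index_iota 0 n | i \in J].
  apply: uniq_perm => //; first by rewrite filter_uniq// iota_uniq.
  by move=> i; rewrite mem_filter mem_index_iota /=;
    case: (boolP (i \in J)) => // /Jn ->.
rewrite (perm_big _ perm) [RHS](perm_big _ perm) !big_filter !big_mkord.
transitivity (U (\big[setI/setT]_(i < n) (iid_seq i @^-1` B' i))).
  congr (U _); rewrite big_mkcond; apply: eq_bigr => i _; rewrite /B'.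
  by case: ifP => // _; rewrite preimage_setT.
rewrite UB' [RHS]big_mkcond; apply: eq_bigr => i _; rewrite /B'.
case: ifP => _; last by rewrite probability_setT.
by rewrite -(iid_seq_law i).
Qed.

End iid_sequence.

(** * Linear functionals and Borel sets of C([0,T]) *)

Section linear_functionals.
Context {R : realType}.

(** An unbundled form of [dual]: combinations and compositions of functionals stay plain
    functions. *)
Definition is_dual (V : normedModType R) (f : V -> R) :=
  (forall (c : R) x y, f (c *: x + y) = c * f x + f y) /\ continuous f.

Lemma is_dual_dual (V : normedModType R) (a : dual V) : is_dual (a : V -> R).
Proof.
split; last exact: (@dual_continuous _ _ a).
by move=> c x y; exact: linearP.
Qed.

Lemma dual_of_is_dual (V : normedModType R) (f : V -> R) :
  is_dual f -> exists a : dual V, f = a.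
Proof.
move=> [fl fc].
have lf : linear (f : V -> R^o) by move=> c x y; exact: fl.
pose F : {linear V -> R^o} := HB.pack (f : V -> R^o) (GRing.isLinear.Build _ _
  _ _ _ lf).
by exists (@Dual R V F fc).
Qed.

Lemma is_dual_lin (V : normedModType R) (f g : V -> R) (k : R) :
  is_dual f -> is_dual g -> is_dual (fun x => k * f x + g x).
Proof.
move=> [fl fc] [gl gc]; split=> [c x y|x]; first by rewrite fl gl; ring.
by apply: cvgD; [apply: cvgM; [exact: cvg_cst|exact: fc]|exact: gc].
Qed.

Lemma is_dual0 (V : normedModType R) : is_dual (fun _ : V => 0 : R).
Proof. by split=> [c x y|x]; [ring|exact: cvg_cst]. Qed.

Lemma is_dual_sum (V : normedModType R) n (k : 'I_n -> R) (f : 'I_n -> V -> R) :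
  (forall i, is_dual (f i)) -> is_dual (fun x => \sum_(i < n) k i * f i x).
Proof.
move=> df; elim: n k f df => [|n IHn] k f df.
  rewrite (_ : (fun _ => _) = fun=> 0); first exact: is_dual0.
  by apply/funext => x; rewrite big_ord0.
rewrite (_ : (fun _ => _) = fun x => k ord0 * f ord0 x +
    \sum_(i < n) k (lift ord0 i) * f (lift ord0 i) x).
  by apply: is_dual_lin => //; exact: IHn.
by apply/funext => x; rewrite big_ord_recl.
Qed.

Lemma is_dual_bounded (V : normedModType R) (f : V -> R) : is_dual f ->
  exists2 K : R, 0 < K & forall x, `|f x| <= K * `|x|.
Proof.
move=> /dual_of_is_dual[a ->].
have /linear_boundedP/pinfty_ex_gt0[K K0 KP] :=
  @continuous_linear_bounded R V R^o 0 a (@dual_continuous _ _ a 0).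
by exists K.
Qed.

Lemma is_dualN (V : normedModType R) (f : V -> R) x : is_dual f -> f (- x) = -
  f x.
Proof. by move=> /dual_of_is_dual[a ->]; exact: linearN. Qed.

Lemma is_dualD (V : normedModType R) (f : V -> R) x y :
  is_dual f -> f (x + y) = f x + f y.
Proof. by move=> /dual_of_is_dual[a ->]; exact: linearD. Qed.

Lemma is_dualZ (V : normedModType R) (f : V -> R) c x :
  is_dual f -> f (c *: x) = c * f x.
Proof. by move=> /dual_of_is_dual[a ->]; exact: linearZ. Qed.

Lemma is_dual_suml (V : normedModType R) (f : V -> R) (I : Type) (r : seq I)
    (P : pred I) (x : I -> V) : is_dual f ->
  f (\sum_(i <- r | P i) x i) = \sum_(i <- r | P i) f (x i).
Proof. by move=> /dual_of_is_dual[a ->]; exact: linear_sum. Qed.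

Lemma bounded_is_dual (V : normedModType R) (f : V -> R) (K : R) :
  (forall (c : R) x y, f (c *: x + y) = c * f x + f y) ->
  (forall x, `|f x| <= K * `|x|) -> is_dual f.
Proof.
move=> fl fK; split=> //.
have lf : linear (f : V -> R^o) by move=> c x y; exact: fl.
pose F : {linear V -> R^o} := HB.pack (f : V -> R^o) (GRing.isLinear.Build _ _
  _ _ _ lf).
apply: (@bounded_linear_continuous R V R^o F).
apply/linear_boundedP; exists K; split; first exact: num_real.
by move=> r Kr y; rewrite (le_trans (fK _))// ler_wpM2r// ltW.
Qed.

Lemma is_dual_eval (T : R) t : is_dual (fun x : C0T T => C0T_fun x t).
Proof.
apply: (@bounded_is_dual _ _ 1) => // x; rewrite mul1r.
exact: C0T_norm_ub.
Qed.

(** The composite of a and u is bounded, so a Riesz representative exists and [xget] does not fall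
    back on 0. *)
Lemma adjointE (H : hilbertType R) (V : normedModType R) (u : {linear H -> V})
    (a : dual V) h : bounded_operator u -> inner (adjoint u a) h = a (u h).
Proof.
move=> [M uM].
have [K K0 aK] := is_dual_bounded (is_dual_dual a).
have [v vP] : exists v, forall h, inner v h = a (u h).
  apply: (@Riesz_representation R H (dual_fun a \o u) (K * M)) => x /=.
  by rewrite (le_trans (aK _))// -mulrA ler_pM2l.
by rewrite /adjoint; case: xgetP => [w _ ->//|/(_ v)].
Qed.

Lemma orthogonal_closure_span (H : hilbertType R) (S : set H) (g w : H) :
  (forall v, S v -> inner g v = 0) -> closure (linear_span S) w ->
  inner g w = 0.
Proof.
move=> gS; have cl : closed [set w : H | inner g w = 0].
  apply: (@preimage_closed _ _ (inner g) [set 0]); last exact: closed_eq.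
  by move=> x _; exact: inner_continuous.
move=> wS; apply: cl; apply: closure_subset wS => v [n [c [y [Sy ->]]]] /=.
rewrite innerC inner_suml big1// => i _.
by rewrite innerZl innerC gS ?mulr0.
Qed.

End linear_functionals.

(** * Borel measurability and almost sure equality of events *)

Section borel_measurability.
Context {R : realType}.

Lemma C0T_continuous_measurable (T : R) (f : C0T T -> R) :
  continuous f -> measurable_fun [set: C0T T] f.
Proof.
move=> fc; apply: (@measurability _ _ _ _ _ _ _ (RGenOpens.measurableE R)).
move=> _ [_ [a [b ->] <-]]; rewrite setTI; apply: sub_sigma_algebra.
by apply: open_comp => [x _|]; [exact: fc|exact: interval_open].
Qed.

Lemma measurable_dual_comp (T : R) d (S : measurableType d) (X : S -> C0T T)
    (f : C0T T -> R) :
  measurable_fun setT X -> is_dual f -> measurable_fun setT (f \o X).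
Proof.
move=> mX [_ fc]; exact: measurableT_comp (C0T_continuous_measurable fc) mX.
Qed.

Lemma C0T_continuous_endo_measurable (T : R) (f : C0T T -> C0T T) :
  continuous f -> measurable_fun [set: C0T T] f.
Proof.
move=> fc; apply: (@measurability _ _ _ _ _ _ (@open (C0T T))) => //.
move=> _ [B oB <-]; rewrite setTI; apply: sub_sigma_algebra.
by apply: open_comp => // x _; exact: fc.
Qed.

Lemma ae_measure_eq d (S : measurableType d) (P : {measure set S -> \bar R})
    (A B : set S) : measurable A -> measurable B ->
  {ae P, forall w, A w <-> B w} -> P A = P B.
Proof.
suff le (A' B' : set S) : measurable A' -> measurable B' ->
    {ae P, forall w, A' w <-> B' w} -> (P A' <= P B')%E.
  move=> mA mB AB; apply/le_anti; rewrite !le//.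
  by apply: filterS AB => w ABw; split; apply ABw.
move=> mA mB [N [mN N0 ABN]]; rewrite -(measureU0 mB mN N0).
apply: le_measure; rewrite ?inE//; first exact: measurableU.
move=> w Aw; have [Bw|nBw] := pselect (B' w); first by left.
by right; apply: ABN => -[AB _]; exact/nBw/AB.
Qed.

End borel_measurability.

(** * Conditional expectation *)

Section conditional_expectation.
Context {R : realType} d (S : measurableType d) (P : probability S R).
Variable gen : set (set S).
Hypothesis gen_measurable : gen `<=` measurable.

Let sub : <<s gen >> `<=` measurable.
Proof. by apply: smallest_sub => //; exact: sigma_algebra_measurable. Qed.

(** Both versions have the integral of Y over the event Z' < Z, which belongs to the
    sub-sigma-algebra. There Z - Z' is positive with integral 0, so the event is null. *)
Lemma is_cond_exp_le (Y Z Z' : S -> R) :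
  is_cond_exp P <<s gen >> Y Z -> is_cond_exp P <<s gen >> Y Z' ->
  {ae P, forall w, Z w <= Z' w}.
Proof.
move=> [mZ iZ EZ] [mZ' iZ' EZ'].
pose E := [set w | Z' w < Z w].
have gE : <<s gen >> E.
  pose gS := g_sigma_algebraType gen.
  have gZ : measurable_fun [set: gS] (Z : gS -> R) by move=> _ B mB;
    rewrite setTI; exact: mZ.
  have gZ' : measurable_fun [set: gS] (Z' : gS -> R) by move=> _ B mB;
    rewrite setTI; exact: mZ'.
  have := measurable_fun_ltr gZ' gZ measurableT (Y := [set true]) I.
  by rewrite setTI.
have mE : measurable E by exact: sub.
have iZE := integrableS measurableT mE (@subsetT _ _) iZ.
have iZE' := integrableS measurableT mE (@subsetT _ _) iZ'.
have mD : measurable_fun E (fun w => (Z w)%:E - (Z' w)%:E)%E.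
  by apply: measurable_int (integrableB mE iZE iZE').
have I0 : (\int[P]_(w in E) `|(Z w)%:E - (Z' w)%:E| = 0)%E.
  rewrite (eq_integral (fun w => ((Z w)%:E - (Z' w)%:E)%E)); last first.
    by move=> w; rewrite inE => Ew; rewrite gee0_abs// sube_ge0// lee_fin ltW.
  rewrite integralB//; rewrite EZ// EZ'//.
  rewrite -EZ// subee//; exact: integrable_fin_num.
have /ae_eq_integral_abs := I0; move=> /(_ mE mD) EN.
apply: filterS EN => w Ew; rewrite leNgt; apply/negP => Zw.
have := Ew Zw; rewrite -EFinB => -[] /eqP; rewrite subr_eq0 => /eqP ZZ.
by move: Zw; rewrite ZZ ltxx.
Qed.

(** Exhibiting one version Z ensures that [xget] picks a genuine version, and comparison in both
    directions makes it almost surely equal to Z. *)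
Lemma cond_exp_ae (Y Z : S -> R) : is_cond_exp P <<s gen >> Y Z ->
  is_cond_exp P <<s gen >> Y (cond_exp P <<s gen >> Y) /\
  {ae P, forall w, cond_exp P <<s gen >> Y w = Z w}.
Proof.
move=> YZ; have YC : is_cond_exp P <<s gen >> Y (cond_exp P <<s gen >> Y).
  by rewrite /cond_exp; case: xgetP => [W _ //|/(_ Z)].
split=> //; apply: filterS2 (is_cond_exp_le YZ YC) (is_cond_exp_le YC YZ).
by move=> w h1 h2; apply/le_anti; rewrite h1 h2.
Qed.

End conditional_expectation.

(** * Gaussian series and conditioning *)

Section gaussian_series.
Context {R : realType} {T : R} {H : hilbertType R} (u : {linear H -> C0T T}).
Variables (D : set nat) (h : nat -> H) (s0 : seq H).
Hypothesis hs0 : forall i, (i < size s0)%N -> D i /\ h i = s0`_i.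

(** The family k is a parameter because both [h] and [reflected_basis] are split after the vectors
    of s0. *)
Lemma series_split (k : nat -> H) (x : nat -> R) m :
  (forall i, (i < size s0)%N -> k i = s0`_i) ->
  \sum_(i < size s0 + m | nat_of_ord i \in D) x i *: u (k i) =
  \sum_(i < size s0) x i *: u s0`_i +
  \sum_(i < m | (size s0 + i)%N \in D)
    x (size s0 + i)%N *: u (k (size s0 + i)%N).
Proof.
move=> ks0; rewrite big_mkcond big_split_ord/=; congr (_ + _);
  last by rewrite -big_mkcond.
apply: eq_bigr => i _; have [Di _] := hs0 (ltn_ord i).
by rewrite mem_set// ks0.
Qed.

Lemma series_tail_cvg (k : nat -> H) (x : nat -> R) (y : C0T T) :
  (forall i, (i < size s0)%N -> k i = s0`_i) ->
  (fun n => \sum_(i < n | nat_of_ord i \in D) x i *: u (k i)) @ \oo --> y ->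
  (fun m => \sum_(i < m | (size s0 + i)%N \in D)
    x (size s0 + i)%N *: u (k (size s0 + i)%N)) @ \oo -->
  y - \sum_(i < size s0) x i *: u s0`_i.
Proof.
move=> ks0 xy.
set c := \sum_(i < _) _.
rewrite (_ : (fun m => _) = fun m =>
    \sum_(i < size s0 + m | nat_of_ord i \in D) x i *: u (k i) - c); last first.
  by apply/funext => m; rewrite series_split// addrC addKr.
apply: cvgB; last exact: cvg_cst.
exact: (cvg_comp _ _ (cvg_addnl (size s0)) xy).
Qed.

Lemma dual_series (f : C0T T -> R) (x : nat -> R) (y : C0T T) :
  is_dual f -> (forall i, D i -> (size s0 <= i)%N -> f (u (h i)) = 0) ->
  (fun n => \sum_(i < n | nat_of_ord i \in D) x i *: u (h i)) @ \oo --> y ->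
  f y = \sum_(i < size s0) x i * f (u s0`_i).
Proof.
move=> fd f0 xy.
have h0 i : (i < size s0)%N -> h i = s0`_i by move=> /hs0[].
have := series_tail_cvg h0 xy; set z := y - _ => tz.
have fz : f z = 0.
  have ftz := cvg_comp _ _ tz (fd.2 z).
  apply: (cvg_unique _ ftz) => //.
  rewrite (_ : f \o _ = cst 0); first exact: cvg_cst.
  apply/funext => m /=; rewrite is_dual_suml// big1// => i.
  by rewrite inE => Di; rewrite is_dualZ// f0 ?mulr0// leq_addr.
rewrite -[y](subrK (\sum_(i < size s0) x i *: u s0`_i)) -/z is_dualD// fz add0r.
by rewrite is_dual_suml//; apply: eq_bigr => i _; rewrite is_dualZ.
Qed.

Definition reflected_basis i := if (i < size s0)%N then h i else - h i.

(** The two series share their head along s0 and have opposite tails, so their limits add up to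
    twice the head. *)
Lemma reflected_series (x : nat -> R) (y y' : C0T T) :
  (fun n => \sum_(i < n | nat_of_ord i \in D) x i *: u (h i)) @ \oo --> y ->
  (fun n => \sum_(i < n | nat_of_ord i \in D) x i *: u (reflected_basis i))
    @ \oo --> y' ->
  y' = 2 *: \sum_(i < size s0) x i *: u s0`_i - y.
Proof.
move=> xy xy'.
have h0 i : (i < size s0)%N -> h i = s0`_i by move=> /hs0[].
have h0' i : (i < size s0)%N -> reflected_basis i = s0`_i.
  by move=> si; rewrite /reflected_basis si h0.
have ty := cvgN (series_tail_cvg h0 xy).
have := series_tail_cvg h0' xy'.
rewrite (_ : (fun m => _) = - (fun m => \sum_(i < m | (size s0 + i)%N \in D)
    x (size s0 + i)%N *: u (h (size s0 + i)%N))); last first.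
  apply/funext => m /=; rewrite fctE -sumrN; apply: eq_bigr => i _.
  by rewrite /reflected_basis ltnNge leq_addr linearN scalerN.
set c := \sum_(i < _) _ => ty'.
have /eqP : y' - c = - (y - c).
  by apply: (cvg_unique (@norm_hausdorff _ _) ty'); exact: ty.
rewrite subr_eq => /eqP ->.
by rewrite opprB addrAC scaler_nat mulr2n.
Qed.

Lemma reflected_basisP : orthonormal_basis [set: H] D h ->
  orthonormal_basis [set: H] D reflected_basis.
Proof.
move=> [oh _ dh]; split => //.
  move=> i j Di Dj; rewrite /reflected_basis.
  have [->|ij] := eqVneq i j.
    by case: ifP; rewrite ?innerNl ?innerNr ?opprK oh// eqxx.
  have h0 : inner (h i) (h j) = 0 by rewrite oh// (negbTE ij).
  by case: ifP => _; case: ifP => _; rewrite ?innerNl ?innerNr h0 ?oppr0.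
apply: (subset_trans dh); apply: closure_subset => _ [n [c [v [vh ->]]]].
(* Each sign change is absorbed into the coefficient, so the linear span is unchanged. *)
have /choice[k kP] : forall i, exists k, D k /\ h k = v i.
  by move=> i; have [k Dk kv] := vh i; exists k.
exists n; exists (fun i => if (k i < size s0)%N then c i else - c i).
exists (reflected_basis \o k); split.
  by move=> i; exists (k i) => //; have [] := kP i.
apply: eq_bigr => i _; have [_ <-] := kP i; rewrite /= /reflected_basis.
by case: ifP => _ //; rewrite scaleNr scalerN opprK.
Qed.

End gaussian_series.

(** * Laws of the functionals of X *)

Section generated_process.
Context {R : realType} {T : R} {H : hilbertType R} (u : {linear H -> C0T T}).
Hypotheses (H_separable : separable H) (u_bounded : bounded_operator u).
Context d (S : measurableType d) (P : probability S R) (X : S -> C0T T).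
Hypotheses (mX : measurable_fun setT X) (X_generated : generated_by P X u).
Local Notation mR := (measurableTypeR R).
Local Notation U := (uniform_prob (@ltr01 R)).
Local Notation xi := (iid_seq (normal_prob (0 : R) 1)).

Lemma generated_sample (D : set nat) (h : nat -> H) :
  D = [set: nat] \/ (exists n, D = `I_n) -> orthonormal_basis [set: H] D h ->
  exists Y : mR -> C0T T, [/\ measurable_fun setT Y,
    {ae U, forall w,
      (fun n => \sum_(i < n | nat_of_ord i \in D) xi i w *: u (h i))
        @ \oo --> Y w} & same_law U Y P X].
Proof.
move=> hD hb; apply: (X_generated hD hb); last exact: iid_seq_independent.
by move=> i; split; [exact: measurable_iid_seq|move=> B mB; exact: iid_seq_law].
Qed.

(* The basis is chosen to start with the normalised Riesz representative of
   [f \o u], so that only one term of the series contributes to [f]. *)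
Lemma dual_law (f : C0T T -> R) : is_dual f ->
  exists2 s : R, 0 <= s & forall B : set R, measurable B ->
    P ((f \o X) @^-1` B) = normal_prob 0 1 ((fun x : mR => s * x : R) @^-1` B).
Proof.
move=> fd; have [a aE] := dual_of_is_dual fd.
pose v := adjoint u a.
have vE g : inner v g = f (u g) by rewrite aE adjointE.
(* If f vanishes on the range of u there is nothing to normalise: s0 is empty, the scale |v| is 0,
   and f of the series is 0. *)
pose s0 := if v == 0 then [::] else [:: `|v|^-1 *: v].
have os0 : orthonormal_seq s0.
  move=> i j; rewrite /s0; case: eqVneq => [//|v0].
  case: i => [|//] _; case: j => [|//] _ /=.
  by rewrite innerZl innerZr inner_norm mulrA -invfM mulVf// mulf_neq0
    ?normr_eq0.
have [D [h [hD hb hs0]]] := orthonormal_basis_extension H_separable os0.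
have [Y [mY cY YX]] := generated_sample hD hb.
have f0 i : D i -> (size s0 <= i)%N -> f (u (h i)) = 0.
  move=> Di si; rewrite -vE; have [v0|v0] := eqVneq v 0;
    first by rewrite v0 inner0l.
  have [ob _ _] := hb.
  move: si hs0; rewrite /s0 (negbTE v0) => si /(_ 0%N isT)[D0 h0].
  have -> : v = `|v| *: h 0%N by rewrite h0/= scalerA divff ?scale1r ?normr_eq0.
  by rewrite innerZl ob// ltn_eqF// mulr0.
exists `|v| => // B mB.
have mfY : measurable_fun setT (f \o Y).
  exact: measurableT_comp (C0T_continuous_measurable fd.2) mY.
have mvx : measurable_fun setT (fun x : mR => `|v| * x : R).
  exact: measurable_funM.
have mvxi : measurable_fun setT (fun w : mR => `|v| * xi 0 w : R).
  by apply: measurable_funM => //; exact: measurable_iid_seq.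
rewrite comp_preimage -[LHS]/(pushforward P X _) -YX; last first.
  by apply: measurable_preimageT => //; exact: C0T_continuous_measurable fd.2.
transitivity (U ((fun w : mR => `|v| * xi 0 w : R) @^-1` B)); last first.
  exact: (@iid_seq_law R (normal_prob 0 1) 0%N _ (measurable_preimageT mvx mB)).
rewrite -[LHS]/(U ((f \o Y) @^-1` B)).
apply: ae_measure_eq; [exact: measurable_preimageT|exact:
  measurable_preimageT|].
apply: filterS cY => w Yw; have := dual_series (x := xi^~ w) hs0 fd f0 Yw.
have -> : \sum_(i < size s0) xi i w * f (u s0`_i) = `|v| * xi 0 w.
  rewrite /s0; case: eqVneq => [->|v0]; first by rewrite big_ord0 normr0 mul0r.
  rewrite big_ord1/= -vE innerZr inner_norm expr2 mulKf ?normr_eq0//.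
  by rewrite mulrC.
by rewrite /= => ->.
Qed.

Lemma dual_gaussian (f : C0T T -> R) : is_dual f -> gaussian_variable P (f \o
  X).
Proof.
move=> fd; split; first exact: measurable_dual_comp.
have [s s0 fs] := dual_law fd; exists 0, s; split=> // B mB.
rewrite /pushforward fs// /gaussian_law; case: eqVneq => [->|sn0].
  rewrite diracE.
  have [B0|B0] := boolP (0 \in B).
    rewrite (_ : _ @^-1` _ = setT) ?probability_setT//.
    by apply/seteqP; split=> // x _ /=; rewrite mul0r; exact: set_mem.
  rewrite (_ : _ @^-1` _ = set0) ?measure0//.
  by apply/seteqP; split=> // x /=; rewrite mul0r => /mem_set;
    rewrite (negbTE B0).
by apply: normal_prob_scale => //; rewrite lt_neqAle eq_sym sn0.
Qed.

Lemma dual_integrable (f : C0T T -> R) : is_dual f ->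
  P.-integrable setT (EFin \o (f \o X)).
Proof.
move=> fd; have mf := measurable_dual_comp mX fd.
have [s s0 fs] := dual_law fd.
pose fX : S -> mR := f \o X.
pose sx : mR -> mR := fun x => s * x.
have mfX : measurable_fun setT fX by [].
have msx : measurable_fun setT sx by exact: measurable_funM.
have mabs : measurable_fun [set: mR] (fun x : mR => `|(x : R)%:E|%E).
  by apply: measurableT_comp => //; exact/measurable_EFinP.
apply/integrableP; split; first exact/measurable_EFinP.
have -> : (\int[P]_x `|(EFin \o (f \o X)) x| =
    \int[pushforward P fX]_x `|(x : R)%:E|)%E.
  by rewrite ge0_integral_pushforward.
rewrite (eq_measure_integral (pushforward (normal_prob 0 1) sx)); last first.
  by move=> A mA _; exact: fs.
rewrite ge0_integral_pushforward//.
have /integrableP[_] := integrableZl measurableT s (@normal_prob_integrable_id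
  R).
by [].
Qed.

End generated_process.

Section continuity.
Context {R : realType} (V : normedModType R).

Lemma continuous_dual_comb n (k : 'I_n -> V -> R) (y : 'I_n -> V) :
  (forall i, is_dual (k i)) -> continuous (fun x => \sum_(i < n) k i x *: y i).
Proof.
elim: n k y => [|n IHn] k y kd x.
  rewrite (_ : (fun z => _) = fun=> 0); first exact: cvg_cst.
  by apply/funext => z; rewrite big_ord0.
rewrite (_ : (fun z => _) = fun z => k ord0 z *: y ord0 +
    \sum_(i < n) k (lift ord0 i) z *: y (lift ord0 i)).
  by apply: cvgD; [apply: cvgZr_tmp; exact: (kd ord0).2|
    apply: IHn => i; exact: kd].
by apply/funext => z; rewrite big_ord_recl.
Qed.

Lemma continuous_scale_sub_id (p : V -> V) (c : R) :
  continuous p -> continuous (fun x => c *: p x - x).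
Proof.
by move=> pc x; apply: cvgB; [apply: cvgZl_tmp; exact: pc|exact: cvg_id].
Qed.

Lemma continuous_id_sub (p : V -> V) :
  continuous p -> continuous (fun x => x - p x).
Proof. by move=> pc x; apply: cvgB; [exact: cvg_id|exact: pc]. Qed.

End continuity.

(** * The reflection and the conditional expectation *)

Section conditioning.
Context {R : realType} {T : R} {H : hilbertType R} (u : {linear H -> C0T T}).
Hypotheses (H_separable : separable H) (u_bounded : bounded_operator u).
Context d (S : measurableType d) (P : probability S R) (X : S -> C0T T).
Hypotheses (mX : measurable_fun setT X) (X_generated : generated_by P X u).
Variables (N : nat) (a : 'I_N -> dual (C0T T)).
Hypothesis a_free : linearly_independent (fun i => adjoint u (a i)).
Variable e : 'I_N -> H.
Hypothesis e_basis :
  orthonormal_basis (detached_space u (range a)) [set: 'I_N] e.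
Local Notation mR := (measurableTypeR R).
Local Notation U := (uniform_prob (@ltr01 R)).
Local Notation omega := (iid_seq (normal_prob (0 : R) 1)).

Let B : 'M[R]_N := \matrix_(i, j) a i (u (e j)).
Let b (x : C0T T) : 'cV[R]_N := \col_i a i x.
Let xi (x : C0T T) : 'cV[R]_N := invmx B *m b x.

Let detached_closure w : detached_space u (range a) w ->
  closure (linear_span (range e)) w.
Proof. by have [_ _] := e_basis; exact. Qed.

(** A row vector c with c B = 0 makes w, the sum of the c_i u^* a_i, orthogonal to every e_j. Since
    w lies in the detached space it is orthogonal to itself, so w = 0 and independence gives c =
    0. *)
Lemma conditions_unitmx : B \in unitmx.
Proof.
rewrite unitmxE unitfE; apply/negP => /det0P[c c0 cB].
pose w := \sum_(i < N) c 0 i *: adjoint u (a i).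
have wE h : inner w h = \sum_(i < N) c 0 i * a i (u h).
  by rewrite inner_suml; apply: eq_bigr => i _; rewrite innerZl adjointE.
have w0 : w = 0.
  apply: inner_sqr_eq0; apply: (@orthogonal_closure_span _ _ (range e)).
    move=> _ [j _ <-]; rewrite wE; move/rowP/(_ j): cB; rewrite !mxE => cB.
    by rewrite -[RHS]cB; apply: eq_bigr => i _; rewrite mxE.
  apply: detached_closure => g ga; rewrite wE big1// => i _.
  by rewrite ga ?mulr0//; exists i.
case/eqP: c0; apply/rowP => i; rewrite mxE.
exact: (a_free (c := c 0) w0).
Qed.

Let xiE x i : xi x i 0 = \sum_(k < N) invmx B i k * a k x.
Proof. by rewrite mxE; apply: eq_bigr => k _; rewrite mxE. Qed.

Let xi_dual i : is_dual (fun x => xi x i 0).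
Proof.
rewrite (_ : (fun x => _) = fun x => \sum_(k < N) invmx B i k * a k x).
  by apply: is_dual_sum => k; exact: is_dual_dual.
by apply/funext => x; rewrite xiE.
Qed.

(** This is the map L; [cond] is x - L x and [refl] is the involution 2 L x - x. *)
Let proj (x : C0T T) : C0T T := \sum_(i < N) xi x i 0 *: u (e i).
Let cond (x : C0T T) : C0T T := x - proj x.
Let refl (x : C0T T) : C0T T := 2 *: proj x - x.

(** Row j of B xi(x) = b(x). *)
Let a_proj j x : a j (proj x) = a j x.
Proof.
rewrite /proj (is_dual_suml _ _ _ (is_dual_dual (a j))).
have <- : (B *m xi x) j 0 = a j x.
  by rewrite mulKVmx ?conditions_unitmx// mxE.
rewrite [RHS]mxE; apply: eq_bigr => i _.
by rewrite (is_dualZ _ _ (is_dual_dual _)) [B j i]mxE mulrC.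
Qed.

Let a_refl j x : a j (refl x) = a j x.
Proof.
rewrite /refl (is_dualD _ _ (is_dual_dual _)) (is_dualN _ (is_dual_dual _)).
by rewrite (is_dualZ _ _ (is_dual_dual _)) a_proj; ring.
Qed.

Let xi_refl x : xi (refl x) = xi x.
Proof. by congr (_ *m _); apply/colP => j; rewrite !mxE a_refl. Qed.

Let proj_refl x : proj (refl x) = proj x.
Proof. by rewrite /proj xi_refl. Qed.

Let cond_refl x : cond (refl x) = - cond x.
Proof.
by rewrite /cond proj_refl /refl opprB scaler_nat mulr2n addrAC addrK.
Qed.

Let continuous_proj : continuous proj.
Proof. exact: continuous_dual_comb. Qed.

Let continuous_refl : continuous refl.
Proof. exact: continuous_scale_sub_id continuous_proj. Qed.

Let continuous_cond : continuous cond.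
Proof. exact: continuous_id_sub continuous_proj. Qed.

Let proj_dual f : is_dual f -> is_dual (fun x => f (proj x)).
Proof.
move=> fd; rewrite (_ : (fun x => _) =
    fun x => \sum_(i < N) f (u (e i)) * xi x i 0); first exact: is_dual_sum.
apply/funext => x; rewrite is_dual_suml//; apply: eq_bigr => i _.
by rewrite is_dualZ// mulrC.
Qed.

Let cond_dual f : is_dual f -> is_dual (fun x => f (cond x)).
Proof.
move=> fd; rewrite (_ : (fun x => _) = fun x => -1 * f (proj x) + f x).
  by apply: is_dual_lin => //; exact: proj_dual.
by apply/funext => x; rewrite is_dualD// is_dualN//; ring.
Qed.

Let basis_seq := [seq e i | i <- enum 'I_N].

Let size_basis_seq : size basis_seq = N.
Proof. by rewrite size_map size_enum_ord. Qed.

Let nth_basis_seq (i : 'I_N) : basis_seq`_i = e i.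
Proof. by rewrite (nth_map i) ?size_enum_ord// nth_ord_enum. Qed.

Let orthonormal_basis_seq : orthonormal_seq basis_seq.
Proof.
have [oe _ _] := e_basis.
move=> i j; rewrite size_basis_seq => iN jN.
by rewrite (nth_basis_seq (Ordinal iN)) (nth_basis_seq (Ordinal jN)) oe.
Qed.

(* Both bases (e, h) and (e, -h) generate X from the same normal variables, and
   the two series differ exactly by the reflection [refl]. *)
Lemma reflection_law (A : set (C0T T)) : measurable A ->
  P (X @^-1` A) = P (X @^-1` (refl @^-1` A)).
Proof.
move=> mA.
have [D [h [hD hb hs0]]] :=
  orthonormal_basis_extension H_separable orthonormal_basis_seq.
have [Y [mY cY YX]] := generated_sample X_generated hD hb.
have hb' := reflected_basisP basis_seq hb.
have [Y' [mY' cY' Y'X]] := generated_sample X_generated hD hb'.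
have mrefl : measurable_fun setT refl.
  exact: C0T_continuous_endo_measurable continuous_refl.
have mrA : measurable (refl @^-1` A) by exact: measurable_preimageT.
rewrite -[LHS]/(pushforward P X A) -[RHS]/(pushforward P X (refl @^-1` A)).
rewrite -Y'X// -YX// -[LHS]/(U (Y' @^-1` A)) -[RHS]/(U (Y @^-1` (refl @^-1`
  A))).
apply: ae_measure_eq; [exact: measurable_preimageT|exact:
  measurable_preimageT|].
apply: filterS2 cY cY' => w Yw Y'w.
(* u^* a_j lies in the detached space, hence in the closed span of the e_k, to which the later
   vectors of h are orthogonal. *)
have a0 j i : D i -> (size basis_seq <= i)%N -> a j (u (h i)) = 0.
  move=> Di Ni; rewrite -adjointE// innerC.
  apply: (@orthogonal_closure_span _ _ (range e)); last first.
    by apply: detached_closure => g ga; rewrite adjointE// ga//; exists j.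
  move=> _ [k _ <-]; have kN : (k < size basis_seq)%N by rewrite size_basis_seq.
  have [Dk] := hs0 k kN; rewrite nth_basis_seq => <-.
  have [oh _ _] := hb; rewrite oh//.
  by rewrite gtn_eqF// (leq_trans _ Ni).
have sumE (V : nmodType) (F : nat -> H -> V) :
    \sum_(i < size basis_seq) F i basis_seq`_i = \sum_(i < N) F i (e i).
  rewrite -(big_mkord xpredT (fun i => F i basis_seq`_i)) size_basis_seq
    big_mkord.
  by apply: eq_bigr => i _; rewrite nth_basis_seq.
(* By [a0] the conditions see only the first N terms, so b (Y w) is B applied to the first N normal
   variables. *)
have xiY : xi (Y w) = \col_i omega i w.
  rewrite /xi (_ : b (Y w) = B *m \col_i omega i w).
    by rewrite mulKmx// conditions_unitmx.
  apply/colP => j; rewrite !mxE.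
  rewrite (dual_series (x := omega^~ w) hs0 (is_dual_dual (a j)) (a0 j) Yw).
  rewrite (sumE _ (fun i g => omega i w * a j (u g))).
  by apply: eq_bigr => i _; rewrite !mxE mulrC.
suff YY' : Y' w = refl (Y w) by rewrite /= YY'.
rewrite (reflected_series (x := omega^~ w) hs0 Yw Y'w) /refl;
  congr (2 *: _ - _).
rewrite (sumE _ (fun i g => omega i w *: u g)) /proj xiY.
by apply: eq_bigr => i _; rewrite mxE.
Qed.

Let G := generated_sigma_algebra X (range a).
Let gen := \bigcup_(c in range a)
  preimage_set_system setT (fun w => c (X w) : R) measurable.

Let gen_measurable : gen `<=` measurable.
Proof.
move=> _ [c [i _ <-]] [A mA <-]; rewrite setTI.
exact: (measurable_preimageT (measurable_dual_comp mX (is_dual_dual (a i)))).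
Qed.

(** The preimages under X of Borel sets invariant under [refl] form a sigma-algebra. It contains the
    generators because [refl] preserves every condition. *)
Let G_reflected E : G E ->
  exists2 A : set (C0T T), measurable A /\ refl @^-1` A = A & E = X @^-1` A.
Proof.
move: E; apply: smallest_sub.
  split.
  - by exists set0; rewrite ?preimage_set0.
  - move=> E [A [mA rA] ->]; exists (~` A); last by rewrite setTD preimage_setC.
    by split; [exact: measurableC|rewrite -preimage_setC rA].
  - move=> E EA; have /choice[A AP] : forall n, exists A : set (C0T T),
        [/\ measurable A, refl @^-1` A = A & E n = X @^-1` A].
      by move=> n; have [A [mA rA] EnA] := EA n; exists A.
    exists (\bigcup_n A n).
      split; first by apply: bigcupT_measurable => n; have [] := AP n.
      by rewrite preimage_bigcup; apply: eq_bigcupr => n _; have [] := AP n.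
    by rewrite preimage_bigcup; apply: eq_bigcupr => n _; have [] := AP n.
move=> _ [c [i _ <-]] [A mA <-]; exists ((a i : C0T T -> R) @^-1` A).
  split; last by apply/seteqP; split=> x; rewrite /= a_refl.
  by apply: measurable_preimageT => //; exact: C0T_continuous_measurable
    (is_dual_dual _).2.
by rewrite setTI.
Qed.

Let integral_cond f E : is_dual f -> G E ->
  (\int[P]_(w in E) (f (cond (X w)))%:E = 0)%E.
Proof.
move=> fd /G_reflected[A [mA rA] ->].
have mrefl : measurable_fun setT refl.
  exact: C0T_continuous_endo_measurable continuous_refl.
pose g (x : C0T T) := (f (cond x))%:E.
have mg : measurable_fun setT g.
  by apply/measurable_EFinP; exact: C0T_continuous_measurable (cond_dual fd).2.
have ig := dual_integrable H_separable u_bounded mX X_generated (cond_dual fd).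
have mXA : measurable (X @^-1` A) by exact: measurable_preimageT.
have igA : P.-integrable (X @^-1` A) (g \o X).
  exact: integrableS measurableT mXA (@subsetT _ _) ig.
have gN x : g (refl x) = (- g x)%E by rewrite /g cond_refl is_dualN.
have mrX : measurable_fun setT (refl \o X) by exact: measurableT_comp.
have rXA : (refl \o X) @^-1` A = X @^-1` A by rewrite comp_preimage rA.
have igN : P.-integrable ((refl \o X) @^-1` A) (g \o (refl \o X)).
  rewrite rXA (_ : g \o _ = -%E \o (g \o X)); first exact: integrableN.
  by apply/funext => w; rewrite /= gN.
have I1 : (\int[P]_(w in X @^-1` A) g (X w) = - \int[P]_(w in X @^-1` A) g (X
  w))%E.
  rewrite -[LHS](integral_pushforward mX mg igA mA).
  (* X and its reflection have the same law, and A is invariant, so the domain of integration stays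
     the same while [cond] changes sign. *)
  rewrite (eq_measure_integral (pushforward P (refl \o X))); last first.
    by move=> C mC _; exact: reflection_law.
  rewrite (integral_pushforward mrX mg igN mA) rXA -integralN//.
    by apply: eq_integral => w _; rewrite /= gN.
  exact: integrable_add_def.
have := integrable_fin_num mXA igA.
move: I1; rewrite /= -/(g _).
case: (integral _ _ _) => // r [] rN _.
by congr EFin; lra.
Qed.

(** f ([proj] X) is a linear combination of the conditions, hence measurable for G; it differs from
    f (X) by f ([cond] X), whose integral over events of G is 0. *)
Let is_cond_exp_proj f : is_dual f ->
  is_cond_exp P G (fun w => f (X w)) (fun w => f (proj (X w))).
Proof.
move=> fd; split.
- pose gS := g_sigma_algebraType gen.
  suff : measurable_fun [set: gS] (fun w : gS => f (proj (X w))).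
    by move=> h A mA; have := h measurableT A mA; rewrite setTI.
  rewrite (_ : (fun w => _) = fun w => \sum_(i < N) f (u (e i)) *
      \sum_(k < N) invmx B i k * a k (X w)); last first.
    apply/funext => w; rewrite is_dual_suml//; apply: eq_bigr => i _.
    by rewrite is_dualZ// mulrC xiE.
  apply: measurable_sum => i; apply: measurable_funM => //.
  apply: measurable_sum => k; apply: measurable_funM => //.
  move=> _ A mA; apply: sub_sigma_algebra; exists (a k); first by exists k.
  by exists A.
- exact: (dual_integrable H_separable u_bounded mX X_generated (proj_dual fd)).
- move=> E GE.
  have mE : measurable E.
    by move: E GE; apply: smallest_sub => //; exact: sigma_algebra_measurable.
  have iP : P.-integrable E (fun w => (f (proj (X w)))%:E).
    apply: integrableS measurableT mE (@subsetT _ _) _.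
    exact: (dual_integrable H_separable u_bounded mX X_generated
      (proj_dual fd)).
  have iC : P.-integrable E (fun w => (f (cond (X w)))%:E).
    apply: integrableS measurableT mE (@subsetT _ _) _.
    exact: (dual_integrable H_separable u_bounded mX X_generated
      (cond_dual fd)).
  rewrite -[LHS]adde0 -(integral_cond fd GE) -integralD//.
  apply: eq_integral => w _; rewrite -EFinD -is_dualD//; congr (f _)%:E.
  by rewrite /cond addrC subrK.
Qed.

Lemma conditioned_process_cond :
  conditioned_process P X (range a) P (fun w => cond (X w)).
Proof.
have mcond : measurable_fun setT (fun w => cond (X w)).
  apply: measurableT_comp mX.
  exact: C0T_continuous_endo_measurable continuous_cond.
split.
  split=> // n t c.
  (* A linear combination of values of [cond] at several times is a single continuous functional of
     X. *)
  apply: (dual_gaussian H_separable u_bounded mX X_generated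
    (f := fun x => \sum_(k < n) c k * C0T_fun (cond x) (t k))).
  apply: (cond_dual (f := fun x => \sum_(k < n) c k * C0T_fun x (t k))).
  by apply: is_dual_sum => k; exact: is_dual_eval.
move=> n c A mA.
have cE k := cond_exp_ae gen_measurable (is_cond_exp_proj (is_dual_dual (c k))).
have mC k : measurable_fun setT (cond_exp P G (fun w => c k (X w))).
  have [[mC _ _] _] := cE k.
  move=> _ C mC'; rewrite setTI.
  have : G `<=` measurable.
    by apply: smallest_sub => //; exact: sigma_algebra_measurable.
  by apply; exact: mC.
rewrite /pushforward; apply: ae_measure_eq.
- apply: measurable_preimageT => //; apply/measurable_fun_tnthP => k.
  rewrite (_ : _ \o _ = (fun x => c k (cond x)) \o X).
    by apply: measurable_dual_comp => //; apply: cond_dual; exact: is_dual_dual.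
  by apply/funext => w; rewrite /= tnth_mktuple.
- apply: measurable_preimageT => //; apply/measurable_fun_tnthP => k.
  rewrite (_ : _ \o _ = fun w => c k (X w) -
      cond_exp P G (fun w => c k (X w)) w); last first.
    by apply/funext => w; rewrite /= tnth_mktuple.
  apply: measurable_funB => //; exact: (measurable_dual_comp mX (is_dual_dual
    (c k))).
(* Only finitely many functionals occur, so their exceptional null sets can be merged and the two
   tuples agree almost surely. *)
have /filter_forall : forall k : 'I_n, {ae P, forall w,
    cond_exp P G (fun w => c k (X w)) w = c k (proj (X w))}.
  by move=> k; have [] := cE k.
apply: filterS => w cw.
suff E : [tuple (c k (cond (X w)) : R) | k < n] =
    [tuple (c k (X w) : R) - cond_exp P G (fun w => c k (X w)) w | k < n].
  by rewrite /preimage/= -E.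
apply: eq_from_tnth => k; rewrite !tnth_mktuple cw.
by rewrite /cond (is_dualD _ _ (is_dual_dual _)) (is_dualN _ (is_dual_dual _)).
Qed.

End conditioning.

Theorem theorem2p6 (R : realType) (T : R) (T_gt0 : 0 < T)
    (H : hilbertType R) (H_separable : separable H)
    (u : {linear H -> C0T T}) (u_bounded : bounded_operator u)
    (d : measure_display) (S : measurableType d) (P : probability S R)
    (X : S -> C0T T)
    (X_gaussian : gaussian_process P X) (X_centered : centered_process P X)
    (X_generated : generated_by P X u)
    (N : nat) (a : 'I_N -> dual (C0T T))
    (a_free : linearly_independent (fun i => adjoint u (a i)))
    (e : 'I_N -> H)
    (e_basis : orthonormal_basis (detached_space u (range a)) [set: 'I_N] e) :
  let B : 'M[R]_N := \matrix_(i, j) a i (u (e j)) in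
  let b (x : C0T T) : 'cV[R]_N := \col_i a i x in
  let xi (x : C0T T) : 'cV[R]_N := invmx B *m b x in
  B \in unitmx /\
  conditioned_process P X (range a) P
    (fun w => X w - \sum_(i < N) xi (X w) i 0 *: u (e i)).
Proof.
have [mX _] := X_gaussian.
by split; [exact: conditions_unitmx|exact: conditioned_process_cond].
Qed.
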